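(* The calculus $LS_{PASL}+D$ is sound and cut-free complete with respect to the class of PASL Kripke relational frames with disjointness: for every formula $F$, (i) if $\emptyset;\emptyset\vdash w:F$ is derivable in $LS_{PASL}+D$ (possibly with cut) for some label $w$, then $F$ is valid over this class of frames; and (ii) if $F$ is valid over this class, then $\emptyset;\emptyset\vdash w:F$ is derivable in $LS_{PASL}+D$ without cut for some label variable $w$.
   Context: Formulae: $A ::= p \mid \top\mid\bot\mid\neg A\mid A\vee A\mid A\wedge A\mid A\to A\mid \top^*\mid A*A\mid A\mathrel{-\!\!*}A$, $p\in Var$. Semantics. A PASL Kripke relational frame is $(H,R,\epsilon)$, $H$ nonempty, $R\subseteq H^3$, $\epsilon\in H$, such that for all $h_i\in H$: $R(h_1,\epsilon,h_2)\iff h_1=h_2$; $R(h_1,h_2,h_3)\iff R(h_2,h_1,h_3)$; $R(h_1,h_5,h_4)\wedge R(h_2,h_3,h_5)\Rightarrow\exists h_6\,(R(h_6,h_3,h_4)\wedge R(h_1,h_2,h_6))$; (cancellativity) $R(h_1,h_2,h_3)\wedge R(h_1,h_4,h_3)\Rightarrow h_2=h_4$; (partial-determinism) $R(h_1,h_2,h_3)\wedge R(h_1,h_2,h_4)\Rightarrow h_3=h_4$. It satisfies disjointness if $R(h_1,h_1,h_2)\Rightarrow h_1=\epsilon$ for all $h_1,h_2$. A model adds $\nu:Var\to\mathcal{P}(H)$; forcing: $h\Vdash p$ iff $h\in\nu(p)$; $\top$ always, $\bot$ never; $\neg,\wedge,\vee,\to$ classical; $h\Vdash\top^*$ iff $h=\epsilon$;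 $h\Vdash A*B$ iff $\exists h_1,h_2$ with $R(h_1,h_2,h)$, $h_1\Vdash A$, $h_2\Vdash B$; $h\Vdash A\mathrel{-\!\!*}B$ iff $\forall h_1,h_2$, $R(h,h_1,h_2)$ and $h_1\Vdash A$ imply $h_2\Vdash B$. $F$ is valid over a class of frames iff forced at every world of every model on a frame in the class. Calculus. Labels: $LVar\cup\{\epsilon\}$. Labelled formula $a:A$; relational atom $(a,b\triangleright c)$; sequent $\mathcal{G};\Gamma\vdash\Delta$ with $\mathcal{G}$ a set of relational atoms and $\Gamma,\Delta$ multisets of labelled formulae; $[y/x]$ ($x$ label variable) uniform replacement; $\neg A:=A\to\bot$, $A\vee B:=\neg A\to B$. $LS_{PASL}$ rules (fresh = label variable not in conclusion): $id$: axiom $\mathcal{G};\Gamma,w:p\vdash w:p,\Delta$; $cut$: $\mathcal{G};\Gamma\vdash x:A,\Delta$ and $\mathcal{G}';\Gamma',x:A\vdash\Delta'\Rightarrow\mathcal{G},\mathcal{G}';\Gamma,\Gamma'\vdash\Delta,\Delta'$; $\bot L$: axiom $\mathcal{G};\Gamma,w:\bot\vdash\Delta$; $\top R$: axiom $\mathcal{G};\Gamma\vdash w:\top,\Delta$; $\top^*R$: axiom $\mathcal{G};\Gamma\vdash\epsilon:\top^*,\Delta$; $\top^*L$: $(\epsilon,w\triangleright\epsilon),\mathcal{G};\Gamma\vdash\Delta\Rightarrow\mathcal{G};\Gamma,w:\top^*\vdash\Delta$; $\wedge L$: $\mathcal{G};\Gamma,w:A,w:B\vdash\Delta\Rightarrow\mathcal{G};\Gamma,w:A\wedge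 B\vdash\Delta$; $\wedge R$: $\mathcal{G};\Gamma\vdash w:A,\Delta$ and $\mathcal{G};\Gamma\vdash w:B,\Delta\Rightarrow\mathcal{G};\Gamma\vdash w:A\wedge B,\Delta$; $\to L$: $\mathcal{G};\Gamma\vdash w:A,\Delta$ and $\mathcal{G};\Gamma,w:B\vdash\Delta\Rightarrow\mathcal{G};\Gamma,w:A\to B\vdash\Delta$; $\to R$: $\mathcal{G};\Gamma,w:A\vdash w:B,\Delta\Rightarrow\mathcal{G};\Gamma\vdash w:A\to B,\Delta$; $*L$: $(x,y\triangleright z),\mathcal{G};\Gamma,x:A,y:B\vdash\Delta\Rightarrow\mathcal{G};\Gamma,z:A*B\vdash\Delta$ ($x,y$ fresh); $\mathrel{-\!\!*}R$: $(x,z\triangleright y),\mathcal{G};\Gamma,x:A\vdash y:B,\Delta\Rightarrow\mathcal{G};\Gamma\vdash z:A\mathrel{-\!\!*}B,\Delta$ ($x,y$ fresh); $*R$: $(x,y\triangleright z),\mathcal{G};\Gamma\vdash x:A,z:A*B,\Delta$ and $(x,y\triangleright z),\mathcal{G};\Gamma\vdash y:B,z:A*B,\Delta\Rightarrow(x,y\triangleright z),\mathcal{G};\Gamma\vdash z:A*B,\Delta$; $\mathrel{-\!\!*}L$: $(x,y\triangleright z),\mathcal{G};\Gamma,y:A\mathrel{-\!\!*}B\vdash x:A,\Delta$ and $(x,y\triangleright z),\mathcal{G};\Gamma,y:A\mathrel{-\!\!*}B,z:B\vdash\Delta\Rightarrow(x,y\triangleright z),\mathcal{G};\Gamma,y:A\mathrel{-\!\!*}B\vdash\Delta$;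 $E$: $(y,x\triangleright z),(x,y\triangleright z),\mathcal{G};\Gamma\vdash\Delta\Rightarrow(x,y\triangleright z),\mathcal{G};\Gamma\vdash\Delta$; $A$: $(u,w\triangleright z),(y,v\triangleright w),(x,y\triangleright z),(u,v\triangleright x),\mathcal{G};\Gamma\vdash\Delta\Rightarrow(x,y\triangleright z),(u,v\triangleright x),\mathcal{G};\Gamma\vdash\Delta$ ($w$ fresh); $U$: $(x,\epsilon\triangleright x),\mathcal{G};\Gamma\vdash\Delta\Rightarrow\mathcal{G};\Gamma\vdash\Delta$; $A_C$: $(x,w\triangleright x),(y,y\triangleright w),(x,y\triangleright x),\mathcal{G};\Gamma\vdash\Delta\Rightarrow(x,y\triangleright x),\mathcal{G};\Gamma\vdash\Delta$ ($w$ fresh); $Eq_1$: $(\epsilon,w'\triangleright w'),\mathcal{G}[w'/w];\Gamma[w'/w]\vdash\Delta[w'/w]\Rightarrow(\epsilon,w\triangleright w'),\mathcal{G};\Gamma\vdash\Delta$; $Eq_2$: same premise $\Rightarrow(\epsilon,w'\triangleright w),\mathcal{G};\Gamma\vdash\Delta$; $P$: $(x,y\triangleright z),\mathcal{G}[z/w];\Gamma[z/w]\vdash\Delta[z/w]\Rightarrow(x,y\triangleright z),(x,y\triangleright w),\mathcal{G};\Gamma\vdash\Delta$; $C$: $(x,y\triangleright z),\mathcal{G}[y/w];\Gamma[y/w]\vdash\Delta[y/w]\Rightarrow(x,y\triangleright z),(x,w\triangleright z),\mathcal{G};\Gamma\vdash\Delta$ (in $Eq_1,Eq_2,P,C$,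 $w$ a label variable). $LS_{PASL}+D$ adds $D$: $(\epsilon,\epsilon\triangleright y),\mathcal{G}[\epsilon/x];\Gamma[\epsilon/x]\vdash\Delta[\epsilon/x]\Rightarrow(x,x\triangleright y),\mathcal{G};\Gamma\vdash\Delta$ ($x$ a label variable).
   Formalization: In (i), ''some label w'' is restricted to label variables: for w = ε the claim fails, since ε:⊤* is an axiom while ⊤* is not valid (it fails at a in the frame {ε, a} having only unit compositions). *)

(* Defs.v *)
From HB Require Import structures.
From mathcomp Require Import all_boot.
From mathcomp Require Import finmap multiset.
From Stdlib Require Import Classical.

Set Implicit Arguments.
Unset Strict Implicit.
Unset Printing Implicit Defensive.

(* [_ |` _] is the operation on finite sets, [_ +` _] the one on multisets. *)
Local Open Scope mset_scope.
Local Open Scope fset_scope.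
Local Open Scope nat_scope.

(* [Emp] is the multiplicative unit.  Negation and disjunction are not primitive: as in the calculus, they are the
   abbreviations [Neg] and [Or] below, whose forcing conditions are the classical
   ones by [force_Neg] and [force_Or]. *)
Inductive formula (Var : Type) : Type :=
| Atom of Var
| Top
| Bot
| And of formula Var & formula Var
| Imp of formula Var & formula Var
| Emp
| Star of formula Var & formula Var
| Wand of formula Var & formula Var.

Arguments Top {Var}.
Arguments Bot {Var}.
Arguments Emp {Var}.

Definition Neg (Var : Type) (A : formula Var) : formula Var := Imp A Bot.
Definition Or (Var : Type) (A B : formula Var) : formula Var := Imp (Neg A) B.

(* [{mset _}] needs a [choiceType] of formulae, obtained by encoding into
   [GenTree.tree]. *)
Fixpoint formula_encode (Var : Type) (A : formula Var) : GenTree.tree Var :=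
  match A with
  | Atom p => GenTree.Leaf p
  | Top => GenTree.Node 0 [::]
  | Bot => GenTree.Node 1 [::]
  | And A B => GenTree.Node 2 [:: formula_encode A; formula_encode B]
  | Imp A B => GenTree.Node 3 [:: formula_encode A; formula_encode B]
  | Emp => GenTree.Node 4 [::]
  | Star A B => GenTree.Node 5 [:: formula_encode A; formula_encode B]
  | Wand A B => GenTree.Node 6 [:: formula_encode A; formula_encode B]
  end.

Fixpoint formula_decode (Var : Type) (t : GenTree.tree Var) : option (formula Var) :=
  match t with
  | GenTree.Leaf p => Some (Atom p)
  | GenTree.Node 0 [::] => Some Top
  | GenTree.Node 1 [::] => Some Bot
  | GenTree.Node 4 [::] => Some Emp
  | GenTree.Node n [:: t1; t2] =>
    match n, formula_decode t1, formula_decode t2 with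
    | 2, Some A, Some B => Some (And A B)
    | 3, Some A, Some B => Some (Imp A B)
    | 5, Some A, Some B => Some (Star A B)
    | 6, Some A, Some B => Some (Wand A B)
    | _, _, _ => None
    end
  | _ => None
  end.

Lemma formula_encodeK (Var : Type) :
  pcancel (@formula_encode Var) (@formula_decode Var).
Proof. by elim=> //= A -> B ->. Qed.

HB.instance Definition _ (Var : choiceType) :=
  Choice.copy (formula Var) (pcan_type (@formula_encodeK Var)).

Record pasl_frame : Type := PaslFrame {
  world :> Type;
  R : world -> world -> world -> Prop;
  unit_world : world;
  R_identity : forall h1 h2, R h1 unit_world h2 <-> h1 = h2;
  R_commutativity : forall h1 h2 h3, R h1 h2 h3 <-> R h2 h1 h3;
  R_associativity : forall h1 h2 h3 h4 h5, R h1 h5 h4 -> R h2 h3 h5 ->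
    exists h6, R h6 h3 h4 /\ R h1 h2 h6;
  R_cancellativity : forall h1 h2 h3 h4, R h1 h2 h3 -> R h1 h4 h3 -> h2 = h4;
  R_partial_determinism : forall h1 h2 h3 h4, R h1 h2 h3 -> R h1 h2 h4 -> h3 = h4
}.

Arguments unit_world {_}.

Definition disjoint_frame (M : pasl_frame) : Prop :=
  forall h1 h2 : M, R h1 h1 h2 -> h1 = unit_world.

Fixpoint force (Var : Type) (M : pasl_frame) (nu : Var -> M -> Prop)
    (h : M) (F : formula Var) : Prop :=
  match F with
  | Atom p => nu p h
  | Top => True
  | Bot => False
  | And A B => force nu h A /\ force nu h B
  | Imp A B => force nu h A -> force nu h B
  | Emp => h = unit_world
  | Star A B =>
      exists h1 h2 : M, [/\ R h1 h2 h, force nu h1 A & force nu h2 B]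
  | Wand A B =>
      forall h1 h2 : M, R h h1 h2 -> force nu h1 A -> force nu h2 B
  end.

Lemma force_Neg (Var : Type) (M : pasl_frame) (nu : Var -> M -> Prop) (h : M) A :
  force nu h (Neg A) <-> ~ force nu h A.
Proof. by []. Qed.

Lemma force_Or (Var : Type) (M : pasl_frame) (nu : Var -> M -> Prop) (h : M) A B :
  force nu h (Or A B) <-> force nu h A \/ force nu h B.
Proof.
split=> /= [AB|[hA|//]]; last by move=> /(_ hA).
by have [hA|nA] := classic (force nu h A); [left|right; apply: AB].
Qed.

Definition valid (Var : Type) (C : pasl_frame -> Prop) (F : formula Var) : Prop :=
  forall M : pasl_frame, C M ->
  forall (nu : Var -> M -> Prop) (h : M), force nu h F.

Definition lvar : choiceType := nat.
Definition label : choiceType := option lvar.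
Definition lv (x : lvar) : label := Some x.
Definition eps : label := None.

(* [(a, b, c)] is the relational atom "(a, b |> c)" and [(a, A)] the labelled
   formula "a : A". *)
Definition ratom : choiceType := (label * label * label)%type.
Definition lformula (Var : choiceType) : choiceType := (label * formula Var)%type.

(* Replacement of the label variable [x] by the label [b]. *)
Definition lsub (b : label) (x : lvar) (a : label) : label :=
  if a == lv x then b else a.

Definition rsub (b : label) (x : lvar) (r : ratom) : ratom :=
  (lsub b x r.1.1, lsub b x r.1.2, lsub b x r.2).

Definition Gsub (b : label) (x : lvar) (G : {fset ratom}) : {fset ratom} :=
  [fset rsub b x r | r in G].

(* The multiset image keeps multiplicities. *)
Definition Fsub (Var : choiceType) (b : label) (x : lvar)
    (Gam : {mset lformula Var}) : {mset lformula Var} :=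
  seq_mset [seq (lsub b x f.1, f.2) | f <- Gam].

Definition fresh (Var : choiceType) (x : lvar) (G : {fset ratom})
    (Gam Del : {mset lformula Var}) : Prop :=
  [/\ forall a b c, (a, b, c) \in G -> [/\ a <> lv x, b <> lv x & c <> lv x],
      forall a A, (a, A) \in Gam -> a <> lv x
    & forall a A, (a, A) \in Del -> a <> lv x].

(* [LSPASLD cut G Gam Del]: the sequent G; Gam |- Del is derivable, using the cut
   rule only if [cut] is [true].  The comma in "(x, y |> z), G" is the union
   [_ |` _] of sets, so [G] may itself contain the displayed atom; the comma in
   the antecedent and the succedent is the sum of multisets.  The freshness
   conditions are about the conclusion, and two eigenvariables introduced by the
   same rule are distinct. *)
Inductive LSPASLD (Var : choiceType) (cut : bool) :
    {fset ratom} -> {mset lformula Var} -> {mset lformula Var} -> Prop :=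
| LS_id G Gam Del w (p : Var) :
    LSPASLD cut G ((w, Atom p) +` Gam) ((w, Atom p) +` Del)
| LS_cut G G' Gam Gam' Del Del' x (A : formula Var) :
    cut ->
    LSPASLD cut G Gam ((x, A) +` Del) ->
    LSPASLD cut G' ((x, A) +` Gam') Del' ->
    LSPASLD cut (G `|` G') (Gam `+` Gam') (Del `+` Del')
| LS_BotL G Gam Del w :
    LSPASLD cut G ((w, Bot) +` Gam) Del
| LS_TopR G Gam Del w :
    LSPASLD cut G Gam ((w, Top) +` Del)
| LS_EmpR G Gam Del :
    LSPASLD cut G Gam ((eps, Emp) +` Del)
| LS_EmpL G Gam Del w :
    LSPASLD cut ((eps, w, eps) |` G) Gam Del ->
    LSPASLD cut G ((w, Emp) +` Gam) Del
| LS_AndL G Gam Del w (A B : formula Var) :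
    LSPASLD cut G ((w, A) +` ((w, B) +` Gam)) Del ->
    LSPASLD cut G ((w, And A B) +` Gam) Del
| LS_AndR G Gam Del w (A B : formula Var) :
    LSPASLD cut G Gam ((w, A) +` Del) ->
    LSPASLD cut G Gam ((w, B) +` Del) ->
    LSPASLD cut G Gam ((w, And A B) +` Del)
| LS_ImpL G Gam Del w (A B : formula Var) :
    LSPASLD cut G Gam ((w, A) +` Del) ->
    LSPASLD cut G ((w, B) +` Gam) Del ->
    LSPASLD cut G ((w, Imp A B) +` Gam) Del
| LS_ImpR G Gam Del w (A B : formula Var) :
    LSPASLD cut G ((w, A) +` Gam) ((w, B) +` Del) ->
    LSPASLD cut G Gam ((w, Imp A B) +` Del)
| LS_StarL G Gam Del (x y : lvar) z (A B : formula Var) :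
    x <> y ->
    fresh x G ((z, Star A B) +` Gam) Del ->
    fresh y G ((z, Star A B) +` Gam) Del ->
    LSPASLD cut ((lv x, lv y, z) |` G)
      ((lv x, A) +` ((lv y, B) +` Gam)) Del ->
    LSPASLD cut G ((z, Star A B) +` Gam) Del
| LS_WandR G Gam Del (x y : lvar) z (A B : formula Var) :
    x <> y ->
    fresh x G Gam ((z, Wand A B) +` Del) ->
    fresh y G Gam ((z, Wand A B) +` Del) ->
    LSPASLD cut ((lv x, z, lv y) |` G)
      ((lv x, A) +` Gam) ((lv y, B) +` Del) ->
    LSPASLD cut G Gam ((z, Wand A B) +` Del)
| LS_StarR G Gam Del x y z (A B : formula Var) :
    LSPASLD cut ((x, y, z) |` G) Gam
      ((x, A) +` ((z, Star A B) +` Del)) ->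
    LSPASLD cut ((x, y, z) |` G) Gam
      ((y, B) +` ((z, Star A B) +` Del)) ->
    LSPASLD cut ((x, y, z) |` G) Gam ((z, Star A B) +` Del)
| LS_WandL G Gam Del x y z (A B : formula Var) :
    LSPASLD cut ((x, y, z) |` G)
      ((y, Wand A B) +` Gam) ((x, A) +` Del) ->
    LSPASLD cut ((x, y, z) |` G)
      ((y, Wand A B) +` ((z, B) +` Gam)) Del ->
    LSPASLD cut ((x, y, z) |` G) ((y, Wand A B) +` Gam) Del
| LS_E G Gam Del x y z :
    LSPASLD cut ((y, x, z) |` ((x, y, z) |` G)) Gam Del ->
    LSPASLD cut ((x, y, z) |` G) Gam Del
| LS_A G Gam Del x y z u v (w : lvar) :
    fresh w ((x, y, z) |` ((u, v, x) |` G)) Gam Del ->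
    LSPASLD cut
      ((u, lv w, z) |` ((y, v, lv w) |` ((x, y, z) |` ((u, v, x) |` G))))
      Gam Del ->
    LSPASLD cut ((x, y, z) |` ((u, v, x) |` G)) Gam Del
| LS_U G Gam Del x :
    LSPASLD cut ((x, eps, x) |` G) Gam Del ->
    LSPASLD cut G Gam Del
| LS_AC G Gam Del x y (w : lvar) :
    fresh w ((x, y, x) |` G) Gam Del ->
    LSPASLD cut ((x, lv w, x) |` ((y, y, lv w) |` ((x, y, x) |` G))) Gam Del ->
    LSPASLD cut ((x, y, x) |` G) Gam Del
| LS_Eq1 G Gam Del (w : lvar) w' :
    LSPASLD cut ((eps, w', w') |` Gsub w' w G) (Fsub w' w Gam) (Fsub w' w Del) ->
    LSPASLD cut ((eps, lv w, w') |` G) Gam Del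
| LS_Eq2 G Gam Del (w : lvar) w' :
    LSPASLD cut ((eps, w', w') |` Gsub w' w G) (Fsub w' w Gam) (Fsub w' w Del) ->
    LSPASLD cut ((eps, w', lv w) |` G) Gam Del
| LS_P G Gam Del x y z (w : lvar) :
    LSPASLD cut ((x, y, z) |` Gsub z w G) (Fsub z w Gam) (Fsub z w Del) ->
    LSPASLD cut ((x, y, z) |` ((x, y, lv w) |` G)) Gam Del
| LS_C G Gam Del x y z (w : lvar) :
    LSPASLD cut ((x, y, z) |` Gsub y w G) (Fsub y w Gam) (Fsub y w Del) ->
    LSPASLD cut ((x, y, z) |` ((x, lv w, z) |` G)) Gam Del
| LS_D G Gam Del (x : lvar) y :
    LSPASLD cut ((eps, eps, y) |` Gsub eps x G) (Fsub eps x Gam) (Fsub eps x Del) ->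
    LSPASLD cut ((lv x, lv x, y) |` G) Gam Del.

(* Main.v *)
Require Import Defs.
From mathcomp Require Import all_boot.
From mathcomp Require Import finmap multiset.
From Stdlib Require Import Classical ClassicalEpsilon.

(* For completeness, an underivable sequent is extended along a fair infinite
   branch of bottom-up rule applications to a Hintikka set, and the canonical
   model is the set of labels modulo occurrence of the atom [(eps, a, b)].  The
   difficulty is that Eq, P, C and D rename labels while the branch grows.  This
   is avoided by never substituting: an equation a = b forced by one of those
   rules is only recorded as the atom [(eps, a, b)].  Renaming labels in a
   cut-free derivation is admissible, and hence so is adding that atom: after a
   and b have been identified it is an instance of U followed by E.  As relational
   atoms form a set, closing them under these equations needs no contraction of
   labelled formulae. *)

Set Implicit Arguments.
Unset Strict Implicit.
Unset Printing Implicit Defensive.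

Local Open Scope mset_scope.
Local Open Scope fset_scope.
Local Open Scope nat_scope.

(** * Soundness *)

Section Calculus.
Variable Var : choiceType.
Implicit Types (G : {fset ratom}) (Gam Del : {mset lformula Var}).
Implicit Types (s t : label -> label).

Section Soundness.
Variables (M : pasl_frame) (nu : Var -> M -> Prop).
Implicit Type rho : label -> M.

Definition rholds rho (r : ratom) : Prop := R (rho r.1.1) (rho r.1.2) (rho r.2).
Definition fholds rho (f : lformula Var) : Prop := force nu (rho f.1) f.2.
Definition sequent_holds rho G Gam Del : Prop :=
  (forall r, r \in G -> rholds rho r) -> (forall f, f \in Gam -> fholds rho f) ->
  exists2 f, f \in Del & fholds rho f.

Lemma R_unitl (h1 h2 : M) : R unit_world h1 h2 <-> h1 = h2.
Proof. by rewrite R_commutativity R_identity. Qed.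

(** Since [rho] gives [w] and [b] the same world, replacing one by the other changes no value. This
    settles Eq, P, C and D alike: the frame axiom behind each rule supplies the equality of
    worlds. *)
Lemma sequent_holds_subst rho b w r0 G Gam Del :
    rho (lv w) = rho b -> rholds rho r0 ->
    sequent_holds rho (r0 |` Gsub b w G) (Fsub b w Gam) (Fsub b w Del) ->
  sequent_holds rho G Gam Del.
Proof.
move=> wb r0h Sh Gh Gamh.
have rhoS a : rho (lsub b w a) = rho a by rewrite /lsub; case: eqP => // ->.
case: Sh => [r|f|f].
- move=> /fset1UP[->//|/imfsetP[r' /= r'G ->]].
  by rewrite /rholds /= !rhoS; apply: Gh.
- rewrite /Fsub (perm_mem (perm_eq_seq_mset _)) => /mapP[g gG ->].
  by rewrite /fholds /= rhoS; apply: Gamh.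
- rewrite /Fsub (perm_mem (perm_eq_seq_mset _)) => /mapP[g gD ->].
  by rewrite /fholds /= rhoS => gh; exists g.
Qed.

Definition upd rho (x : lvar) (h : M) (a : label) : M :=
  if a == lv x then h else rho a.

Lemma updE rho x h : upd rho x h (lv x) = h.
Proof. by rewrite /upd eqxx. Qed.

Lemma upd_id rho x h a : a <> lv x -> upd rho x h a = rho a.
Proof. by move=> /eqP/negbTE ax; rewrite /upd ax. Qed.

Lemma fresh_upd rho x h G Gam Del : fresh x G Gam Del ->
  [/\ forall r, r \in G -> rholds (upd rho x h) r <-> rholds rho r,
      forall f, f \in Gam -> fholds (upd rho x h) f <-> fholds rho f
    & forall f, f \in Del -> fholds (upd rho x h) f <-> fholds rho f].
Proof.
move=> [xG xL xR]; split.
- by move=> [[a b] c] /xG[ax bx cx]; rewrite /rholds /= !upd_id.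
- by move=> [a A] /xL ax; rewrite /fholds /= upd_id.
- by move=> [a A] /xR ax; rewrite /fholds /= upd_id.
Qed.

(** The valuation [rho] is quantified after the derivation, so that the induction hypothesis can be
    used at valuations that send the eigenvariables to the worlds witnessing the rule. *)
Lemma LS_sound cut G Gam Del :
    disjoint_frame M -> LSPASLD cut G Gam Del ->
  forall rho, rho eps = unit_world -> sequent_holds rho G Gam Del.
Proof.
move=> Mdis D; elim: D => {G Gam Del}.
- move=> G Gam Del w p rho _ _ Gamh; exists (w, Atom p); rewrite ?mset1D1 //.
  by apply: Gamh; rewrite mset1D1.
- move=> G G' Gam Gam' Del Del' x A _ _ IH1 _ IH2 rho re Gh Gamh.
  have [||f /msetDP[|] fD fh] := IH1 rho re.
  + by move=> r rG; apply: Gh; rewrite inE rG.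
  + by move=> f fG; apply: Gamh; rewrite in_msetD fG.
  + have [||g gD gh] := IH2 rho re.
    * by move=> r rG; apply: Gh; rewrite inE rG orbT.
    * move=> g /msetDP[|gG]; last by apply: Gamh; rewrite in_msetD gG orbT.
      by move=> /mset1P ->; move/mset1P: fD fh => ->.
    * by exists g => //; rewrite in_msetD gD orbT.
  + by exists f => //; rewrite in_msetD fD.
- by move=> G Gam Del w rho _ _ Gamh; case: (Gamh (w, Bot)); rewrite mset1D1.
- by move=> G Gam Del w rho _ _ Gamh; exists (w, Top); rewrite ?mset1D1.
- by move=> G Gam Del rho re _ Gamh; exists (eps, Emp); rewrite ?mset1D1.
- move=> G Gam Del w _ IH rho re Gh Gamh; apply: (IH rho re).
    move=> r /fset1UP[->|]; last exact: Gh.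
    rewrite /rholds /= re; apply/R_unitl.
    by apply: (Gamh (w, Emp)); rewrite mset1D1.
  by move=> f fG; apply: Gamh; rewrite mset1Dr.
- move=> G Gam Del w A B _ IH rho re Gh Gamh; apply: (IH rho re) => // f.
  have [wA wB] := Gamh (w, And A B) (mset1D1 _ _).
  move=> /msetDP[/mset1P->//|/msetDP[/mset1P->//|fG]].
  by apply: Gamh; rewrite mset1Dr.
- move=> G Gam Del w A B _ IH1 _ IH2 rho re Gh Gamh.
  have [f /msetDP[/mset1P->|] fD] := IH1 rho re Gh Gamh; last by exists f; rewrite ?mset1Dr.
  have [g /msetDP[/mset1P->|] gD] := IH2 rho re Gh Gamh; last by exists g; rewrite ?mset1Dr.
  by exists (w, And A B); rewrite ?mset1D1.
- move=> G Gam Del w A B _ IH1 _ IH2 rho re Gh Gamh.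
  have wAB := Gamh (w, Imp A B) (mset1D1 _ _).
  have {}Gamh f : f \in Gam -> fholds rho f by move=> fG; apply: Gamh; rewrite mset1Dr.
  have [f /msetDP[/mset1P->|] fD] := IH1 rho re Gh Gamh; last by exists f.
  apply: (IH2 rho re Gh) => g /msetDP[/mset1P->|]; [exact: wAB|exact: Gamh].
- move=> G Gam Del w A B _ IH rho re Gh Gamh.
  (* If [A] fails at [w], the implication holds there and is itself the true succedent formula. *)
  have [wA|nwA] := classic (fholds rho (w, A)); last first.
    by exists (w, Imp A B); rewrite ?mset1D1 // => /nwA.
  have Gamh' f : f \in (w, A) +` Gam -> fholds rho f by move=> /msetDP[/mset1P->|/Gamh].
  have [f /msetDP[/mset1P->|fD] fh] := IH rho re Gh Gamh'.
  + by exists (w, Imp A B); rewrite ?mset1D1.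
  + by exists f; rewrite ?mset1Dr.
- move=> G Gam Del x y z A B xy fx fy _ IH rho re Gh Gamh.
  have [h1 [h2 [hz h1A h2B]]] := Gamh (z, Star A B) (mset1D1 _ _).
  have [xG xL xR] := fresh_upd (upd rho y h2) h1 fx.
  have [yG yL yR] := fresh_upd rho h2 fy.
  set rho' := upd (upd rho y h2) x h1 in xG xL xR.
  have r'x : rho' (lv x) = h1 by apply: updE.
  have r'y : rho' (lv y) = h2.
    by rewrite /rho' upd_id ?updE // => -[/esym].
  have r'z : rho' z = rho z.
    case: fx fy => _ /(_ z (Star A B) (mset1D1 _ _)) zx _ [_ /(_ z (Star A B) (mset1D1 _ _)) zy _].
    by rewrite /rho' !upd_id.
  have [||f fD fh] := IH rho' re.
  + move=> r /fset1UP[->|rG]; first by rewrite /rholds /= r'x r'y r'z.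
    by apply/xG/yG/Gh.
  + move=> f /msetDP[/mset1P->|]; first by rewrite /fholds r'x.
    move=> /msetDP[/mset1P->|fG]; first by rewrite /fholds r'y.
    by have fG' := mset1Dr (z, Star A B) fG; apply/xL/yL/Gamh.
  + by exists f => //; apply/yR/xR.
- move=> G Gam Del x y z A B xy fx fy _ IH rho re Gh Gamh.
  have [zAB|nzAB] := classic (fholds rho (z, Wand A B)).
    by exists (z, Wand A B); rewrite ?mset1D1.
  have [h1 /not_all_ex_not[h2 h12]] := not_all_ex_not _ _ nzAB.
  have [hz h1A h2B] : [/\ R (rho z) h1 h2, force nu h1 A & ~ force nu h2 B].
    by split; [apply: NNPP => n|apply: NNPP => n|move=> n]; apply: h12.
  have [xG xL xR] := fresh_upd (upd rho y h2) h1 fx.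
  have [yG yL yR] := fresh_upd rho h2 fy.
  set rho' := upd (upd rho y h2) x h1 in xG xL xR.
  have r'x : rho' (lv x) = h1 by apply: updE.
  have r'y : rho' (lv y) = h2.
    by rewrite /rho' upd_id ?updE // => -[/esym].
  have r'z : rho' z = rho z.
    case: fx fy => _ _ /(_ z (Wand A B) (mset1D1 _ _)) zx [_ _ /(_ z (Wand A B) (mset1D1 _ _)) zy].
    by rewrite /rho' !upd_id.
  have [||f /msetDP[/mset1P->|fD] fh] := IH rho' re.
  + move=> r /fset1UP[->|rG]; last by apply/xG/yG/Gh.
    by rewrite /rholds /= r'x r'y r'z; apply/R_commutativity.
  + move=> f /msetDP[/mset1P->|]; first by rewrite /fholds r'x.
    by move=> fG; apply/xL/yL/Gamh.
  + by case: h2B; move: fh; rewrite /fholds /= r'y.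
  + by have fD' := mset1Dr (z, Wand A B) fD; exists f => //; apply/yR/xR.
- move=> G Gam Del x y z A B _ IH1 _ IH2 rho re Gh Gamh.
  have [f /msetDP[/mset1P->|] fD] := IH1 rho re Gh Gamh; last by exists f.
  have [g /msetDP[/mset1P->|] gD] := IH2 rho re Gh Gamh; last by exists g.
  exists (z, Star A B); first by rewrite ?mset1D1.
  by exists (rho x), (rho y); split=> //; apply: (Gh (x, y, z)); apply: fset1U1.
- move=> G Gam Del x y z A B _ IH1 _ IH2 rho re Gh Gamh.
  have [f /msetDP[/mset1P->|fD] fh] := IH1 rho re Gh Gamh; last by exists f.
  apply: (IH2 rho re Gh) => g /msetDP[/mset1P->|].
    by apply: Gamh; apply: mset1D1.
  move=> /msetDP[/mset1P->|gG]; last by apply: Gamh; apply: mset1Dr.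
  have := Gamh (y, Wand A B) (mset1D1 _ _); apply; last exact: fh.
  by apply/R_commutativity; apply: (Gh (x, y, z)); apply: fset1U1.
- move=> G Gam Del x y z _ IH rho re Gh; apply: (IH rho re) => r /fset1UP[->|]; last exact: Gh.
  by apply/R_commutativity; apply: (Gh (x, y, z)); apply: fset1U1.
- move=> G Gam Del x y z u v w fw _ IH rho re Gh Gamh.
  have xyz : R (rho x) (rho y) (rho z) by apply: (Gh (x, y, z)); rewrite !inE eqxx.
  have uvx : R (rho u) (rho v) (rho x) by apply: (Gh (u, v, x)); rewrite !inE eqxx orbT.
  (* The frame axiom decomposes the second argument and rule A the first one, so both atoms are
     swapped beforehand and the results swapped back where needed. *)
  have [h [h1 h2]] := R_associativity (proj1 (R_commutativity _ _ _) xyz) (proj1 (R_commutativity _ _ _) uvx).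
  have [wG wL wR] := fresh_upd rho h fw.
  have [||f fD fh] := IH (upd rho w h) re.
  + case: fw => fwG _ _.
    have [wx wy wz] := fwG x y z (fset1U1 _ _).
    have [wu wv _] := fwG u v x (fset1Ur _ (fset1U1 _ _)).
    move=> r /fset1UP[->|/fset1UP[->|rG]]; last by apply/wG/Gh.
      by rewrite /rholds /= updE !upd_id //; apply/R_commutativity.
    by rewrite /rholds /= updE !upd_id.
  + by move=> f fG; apply/wL/Gamh.
  + by exists f => //; apply/wR.
- move=> G Gam Del x _ IH rho re Gh; apply: (IH rho re) => r /fset1UP[->|]; last exact: Gh.
  by rewrite /rholds /= re; apply/R_identity.
- move=> G Gam Del x y w fw _ IH rho re Gh Gamh.
  have xyx : R (rho x) (rho y) (rho x) by apply: (Gh (x, y, x)); rewrite !inE eqxx.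
  have yxx := proj1 (R_commutativity _ _ _) xyx.
  (* A_C is associativity with the same atom in both roles. *)
  have [h [h1 h2]] := R_associativity yxx yxx.
  have [wG wL wR] := fresh_upd rho h fw.
  have [||f fD fh] := IH (upd rho w h) re.
  + case: fw => fwG _ _; have [wx wy _] := fwG x y x (fset1U1 _ _).
    move=> r /fset1UP[->|/fset1UP[->|rG]]; last by apply/wG/Gh.
      by rewrite /rholds /= updE !upd_id //; apply/R_commutativity.
    by rewrite /rholds /= updE !upd_id.
  + by move=> f fG; apply/wL/Gamh.
  + by exists f => //; apply/wR.
- move=> G Gam Del w w' _ IH rho re Gh.
  have ww' : rho (lv w) = rho w'.
    by apply/R_unitl; rewrite -re; apply: (Gh (eps, lv w, w')); apply: fset1U1.
  apply: (sequent_holds_subst ww' _ (IH rho re)) => [|r rG].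
    by rewrite /rholds /= re; apply/R_unitl.
  by apply: Gh; apply: fset1Ur.
- move=> G Gam Del w w' _ IH rho re Gh.
  have ww' : rho (lv w) = rho w'.
    by apply/esym/R_unitl; rewrite -re; apply: (Gh (eps, w', lv w)); apply: fset1U1.
  apply: (sequent_holds_subst ww' _ (IH rho re)) => [|r rG].
    by rewrite /rholds /= re; apply/R_unitl.
  by apply: Gh; apply: fset1Ur.
- move=> G Gam Del x y z w _ IH rho re Gh.
  have xyz := Gh (x, y, z) (fset1U1 _ _).
  have xyw := Gh (x, y, lv w) (fset1Ur _ (fset1U1 _ _)).
  apply: (sequent_holds_subst (R_partial_determinism xyw xyz) xyz (IH rho re)) => r rG.
  by apply: Gh; do 2!apply: fset1Ur.
- move=> G Gam Del x y z w _ IH rho re Gh.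
  have xyz := Gh (x, y, z) (fset1U1 _ _).
  have xwz := Gh (x, lv w, z) (fset1Ur _ (fset1U1 _ _)).
  apply: (sequent_holds_subst (R_cancellativity xwz xyz) xyz (IH rho re)) => r rG.
  by apply: Gh; do 2!apply: fset1Ur.
- move=> G Gam Del x y _ IH rho re Gh.
  have xxy : R (rho (lv x)) (rho (lv x)) (rho y) := Gh (lv x, lv x, y) (fset1U1 _ _).
  have xe : rho (lv x) = rho eps by rewrite re; apply: Mdis xxy.
  apply: (sequent_holds_subst xe _ (IH rho re)) => [|r rG].
    by rewrite /rholds /= -xe.
  by apply: Gh; apply: fset1Ur.
Qed.

End Soundness.

(** * Renaming of labels in cut-free derivations *)

Definition rren s (r : ratom) : ratom := (s r.1.1, s r.1.2, s r.2).
Definition fren s (f : lformula Var) : lformula Var := (s f.1, f.2).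
Definition mren s Gam : {mset lformula Var} := seq_mset [seq fren s f | f <- Gam].

Lemma mren_cons s f Gam : mren s (f +` Gam) = fren s f +` mren s Gam.
Proof.
rewrite -mset_cons; apply/eq_seq_msetP; rewrite -map_cons perm_map //.
by rewrite -{1}(seq_mset_id Gam) -mset_cons perm_eq_seq_mset.
Qed.

Lemma mren_comp s t Gam : mren s (mren t Gam) = mren (s \o t) Gam.
Proof.
apply/eq_seq_msetP; rewrite -[X in perm_eq _ X]/(map ((fren s) \o (fren t)) _).
by rewrite map_comp perm_map // perm_eq_seq_mset.
Qed.

Lemma eq_mren s t Gam :
  (forall f, f \in Gam -> s f.1 = t f.1) -> mren s Gam = mren t Gam.
Proof.
move=> st; congr seq_mset; apply/eq_in_map => f fG; rewrite /fren st //.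
Qed.

Lemma mren_id Gam : mren id Gam = Gam.
Proof.
by rewrite /mren -[RHS]seq_mset_id; congr seq_mset; rewrite -[RHS]map_id;
  apply: eq_map => -[].
Qed.

(** Relational atoms form a set, so a principal atom that belongs to [G] can be displayed without
    changing [G]. This lemma and the next three restate rules with membership in place of
    display. *)
Lemma LS_StarR_mem cut G Gam Del x y z (A B : formula Var) :
  (x, y, z) \in G ->
  LSPASLD cut G Gam ((x, A) +` ((z, Star A B) +` Del)) ->
  LSPASLD cut G Gam ((y, B) +` ((z, Star A B) +` Del)) ->
  LSPASLD cut G Gam ((z, Star A B) +` Del).
Proof. by move=> /mem_fset1U <-; apply: LS_StarR. Qed.

Lemma LS_WandL_mem cut G Gam Del x y z (A B : formula Var) :
  (x, y, z) \in G ->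
  LSPASLD cut G ((y, Wand A B) +` Gam) ((x, A) +` Del) ->
  LSPASLD cut G ((y, Wand A B) +` ((z, B) +` Gam)) Del ->
  LSPASLD cut G ((y, Wand A B) +` Gam) Del.
Proof. by move=> /mem_fset1U <-; apply: LS_WandL. Qed.

Lemma LS_E_mem cut G Gam Del x y z :
  (x, y, z) \in G ->
  LSPASLD cut ((y, x, z) |` G) Gam Del -> LSPASLD cut G Gam Del.
Proof. by move=> /mem_fset1U <-; apply: LS_E. Qed.

Lemma LS_A_mem cut G Gam Del x y z u v (w : lvar) :
  (x, y, z) \in G -> (u, v, x) \in G -> fresh w G Gam Del ->
  LSPASLD cut ((u, lv w, z) |` ((y, v, lv w) |` G)) Gam Del ->
  LSPASLD cut G Gam Del.
Proof.
by move=> /mem_fset1U zG /mem_fset1U xG; rewrite -zG -xG; apply: LS_A.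
Qed.

Lemma lsub_eps b w : lsub b w eps = eps. Proof. by []. Qed.

Lemma lsub_unif b w : lsub b w (lv w) = lsub b w b.
Proof. by rewrite /lsub eqxx; case: ifP. Qed.

(** * Identification of labels *)

(** Asking for every [G'] that contains the renamed atoms, not only for their image, builds
    weakening into the notion. *)
Definition derivable_under s G Gam Del :=
  forall G', (forall r, r \in G -> rren s r \in G') ->
    LSPASLD false G' (mren s Gam) (mren s Del).

(* Bottom-up, any equality [a = b] may be assumed when deriving the sequent. *)
Definition unifiable a b G Gam Del :=
  (forall s, s eps = eps -> s a = s b -> derivable_under s G Gam Del) ->
  LSPASLD false G Gam Del.

Lemma unifiable_refl a G Gam Del : unifiable a a G Gam Del.
Proof.
move=> /(_ id erefl erefl); rewrite /derivable_under !mren_id; apply.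
by move=> [[]].
Qed.

Lemma mem_Gsub b w G r r' :
  r \in G -> rren (lsub b w) r \in r' |` Gsub b w G.
Proof. by move=> rG; rewrite fset1Ur //; apply: in_imfset. Qed.

Lemma unifiable_sym a b G Gam Del :
  unifiable a b G Gam Del -> unifiable b a G Gam Del.
Proof. by move=> + H; apply=> s se sab; apply: H. Qed.

(** The substituting rules replace label variables only. If one of the two labels is a variable,
    symmetry of [Q] lets it come first; otherwise both are [eps] and there is nothing to
    identify. *)
Lemma unifiable_wlog (Q : label -> label -> Prop) G Gam Del :
  (forall a b, Q a b -> Q b a) ->
  (forall w b, Q (lv w) b -> unifiable (lv w) b G Gam Del) ->
  forall a b, Q a b -> unifiable a b G Gam Del.
Proof.
move=> Qsym Qv [w|] [w'|] Qab; try exact: Qv; last exact: unifiable_refl.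
by apply/unifiable_sym/Qv/Qsym.
Qed.

Lemma unifiable_Eq a b G Gam Del :
  (eps, a, b) \in G -> unifiable a b G Gam Del.
Proof.
move=> abG.
(* The atom is not symmetric in [a] and [b], so the relation is symmetrised; its two disjuncts are
   served by Eq1 and Eq2. *)
apply: (@unifiable_wlog (fun a b => (eps, a, b) \in G \/ (eps, b, a) \in G));
  last by left.
  by move=> a' b' []; [right|left].
move=> w b' [] /mem_fset1U wG H; rewrite -wG; [apply: LS_Eq1|apply: LS_Eq2];
  apply: (H _ (lsub_eps _ _) (lsub_unif _ _)) => r; apply: mem_Gsub.
Qed.

Lemma unifiable_P x y a b G Gam Del :
  (x, y, a) \in G -> (x, y, b) \in G -> unifiable a b G Gam Del.
Proof.
move=> aG bG.
apply: (@unifiable_wlog (fun a b => (x, y, a) \in G /\ (x, y, b) \in G)) => //.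
  by move=> ? ? [].
move=> w c [/mem_fset1U wG /mem_fset1U cG] H; rewrite -cG -wG; apply: LS_P.
by apply: (H _ (lsub_eps _ _) (lsub_unif _ _)) => r; apply: mem_Gsub.
Qed.

Lemma unifiable_C x z a b G Gam Del :
  (x, a, z) \in G -> (x, b, z) \in G -> unifiable a b G Gam Del.
Proof.
move=> aG bG.
apply: (@unifiable_wlog (fun a b => (x, a, z) \in G /\ (x, b, z) \in G)) => //.
  by move=> ? ? [].
move=> w c [/mem_fset1U wG /mem_fset1U cG] H; rewrite -cG -wG; apply: LS_C.
by apply: (H _ (lsub_eps _ _) (lsub_unif _ _)) => r; apply: mem_Gsub.
Qed.

Lemma unifiable_D x y G Gam Del :
  (x, x, y) \in G -> unifiable x eps G Gam Del.
Proof.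
case: x => [w|] /mem_fset1U wG; last exact: unifiable_refl.
move=> H; rewrite -wG; apply: LS_D.
by apply: (H _ (lsub_eps _ _) (lsub_unif _ _)) => r; apply: mem_Gsub.
Qed.

Lemma fresh_above G Gam Del :
  exists N, forall w, N <= w -> fresh w G Gam Del.
Proof.
(* Any variable from [bnd a] on differs from [a]; the label [eps] imposes no bound. *)
pose bnd (a : label) := if a is Some n then n.+1 else 0.
have bndP a w : bnd a <= w -> a <> lv w by case: a => // n /= + [nw]; rewrite nw ltnn.
pose m (T : eqType) (f : T -> nat) (l : seq T) := \max_(i <- l) f i.
have mP (T : eqType) (f : T -> nat) (l : seq T) i : i \in l -> f i <= m T f l.
  by move=> il; rewrite /m; apply: leq_bigmax_seq.
pose fr (r : ratom) := bnd r.1.1 + bnd r.1.2 + bnd r.2.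
pose ff (f : lformula Var) := bnd f.1.
exists (m _ fr (enum_fset G) + m _ ff Gam + m _ ff Del) => w Nw; split.
- move=> a b c abcG.
  have := mP _ fr (enum_fset G) _ abcG; rewrite /fr /= => le.
  have {}le : bnd a + bnd b + bnd c <= w.
    by apply: leq_trans le (leq_trans _ Nw); rewrite -addnA leq_addr.
  split; apply: bndP; apply: leq_trans le.
  + by rewrite -addnA leq_addr.
  + by rewrite addnAC leq_addl.
  + by rewrite leq_addl.
- move=> a A aG; apply: bndP; apply: leq_trans (mP _ ff _ _ aG) (leq_trans _ Nw).
  by rewrite addnAC leq_addl.
- move=> a A aG; apply: bndP; apply: leq_trans (mP _ ff _ _ aG) (leq_trans _ Nw).
  by rewrite leq_addl.
Qed.

Lemma fresh_pair G Gam Del :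
  exists x y, [/\ x <> y, fresh x G Gam Del & fresh y G Gam Del].
Proof.
have [N NP] := fresh_above G Gam Del; exists N, N.+1.
by split; [apply: n_Sn|apply: NP|apply: NP].
Qed.

(** When [s] equates [w] and [b], composing it with the substitution gives [s] again. Hence the
    renamed premise of a substituting rule already has the formulae of its renamed conclusion. *)
Lemma derivable_under_subst s b w r0 G G' Gam Del :
    derivable_under s (r0 |` Gsub b w G) (Fsub b w Gam) (Fsub b w Del) ->
    s (lv w) = s b -> rren s r0 \in G' ->
    (forall r, r \in G -> rren s r \in G') ->
  LSPASLD false G' (mren s Gam) (mren s Del).
Proof.
move=> D swb r0G' GG'.
have ss a : s (lsub b w a) = s a by rewrite /lsub; case: eqP => // ->.
have sF Gam' : mren s (Fsub b w Gam') = mren s Gam'.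
  by rewrite [LHS]mren_comp; apply: eq_mren => f _; apply: ss.
have := D G'; rewrite !sF; apply=> r /fset1UP[->//|/imfsetP[r' /= r'G ->]].
by have := GG' _ r'G; rewrite /rren /rsub /= !ss.
Qed.

(* Renaming and weakening of the relational atoms are admissible; proving both
   at once lets eigenvariables be renamed apart from the new atoms. *)
Lemma LS_ren G Gam Del s : LSPASLD false G Gam Del -> s eps = eps ->
  derivable_under s G Gam Del.
Proof.
move=> D; elim: D s => {G Gam Del}.
- by move=> G Gam Del w p s _ G' _; rewrite !mren_cons; apply: LS_id.
(* The cut case is vacuous, as the flag is [false]. *)
- by [].
- by move=> G Gam Del w s _ G' _; rewrite !mren_cons; apply: LS_BotL.
- by move=> G Gam Del w s _ G' _; rewrite !mren_cons; apply: LS_TopR.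
- move=> G Gam Del s se G' _; rewrite !mren_cons /fren /= se; exact: LS_EmpR.
- move=> G Gam Del w _ IH s se G' GG'; rewrite !mren_cons; apply: LS_EmpL.
  apply: IH => // r /fset1UP[->|/GG' ?]; last exact: fset1Ur.
  by rewrite /rren /= se fset1U1.
- move=> G Gam Del w A B _ IH s se G' GG'; rewrite !mren_cons; apply: LS_AndL.
  by have := IH s se G' GG'; rewrite !mren_cons.
- move=> G Gam Del w A B _ IH1 _ IH2 s se G' GG'; rewrite !mren_cons; apply: LS_AndR.
    by have := IH1 s se G' GG'; rewrite !mren_cons.
  by have := IH2 s se G' GG'; rewrite !mren_cons.
- move=> G Gam Del w A B _ IH1 _ IH2 s se G' GG'; rewrite !mren_cons; apply: LS_ImpL.
    by have := IH1 s se G' GG'; rewrite !mren_cons.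
  by have := IH2 s se G' GG'; rewrite !mren_cons.
- move=> G Gam Del w A B _ IH s se G' GG'; rewrite !mren_cons; apply: LS_ImpR.
  by have := IH s se G' GG'; rewrite !mren_cons.
- move=> G Gam Del x y z A B xy [xG xL xR] [yG yL yR] _ IH s se G' GG'.
  have [x' [y' [xy' fx' fy']]] :=
    fresh_pair G' (mren s ((z, Star A B) +` Gam)) (mren s Del).
  (* The eigenvariables are sent to variables fresh for all of [G'], which may contain arbitrary
     further atoms. They do not occur in the conclusion, where [s'] and [s] therefore agree. *)
  pose s' a := if a == lv x then lv x' else if a == lv y then lv y' else s a.
  have s'x : s' (lv x) = lv x' by rewrite /s' eqxx.
  have s'y : s' (lv y) = lv y'.
    by rewrite /s' eqxx; case: eqP => // -[/esym].
  have s's a : a <> lv x -> a <> lv y -> s' a = s a.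
    by move=> /eqP/negbTE ax /eqP/negbTE ay; rewrite /s' ax ay.
  have s'L f : f \in (z, Star A B) +` Gam -> s' f.1 = s f.1.
    by case: f => a C aG; apply: s's; [apply: xL aG|apply: yL aG].
  have s'R f : f \in Del -> s' f.1 = s f.1.
    by case: f => a C aG; apply: s's; [apply: xR aG|apply: yR aG].
  have s'z : s' z = s z by apply: (s'L (z, Star A B)); apply: mset1D1.
  have s'L' : mren s' Gam = mren s Gam.
    by apply: eq_mren => f fG; apply: s'L; rewrite mset1Dr.
  move: fx' fy'; rewrite mren_cons => fx' fy'; apply: (LS_StarL xy') => //.
  have := IH s' _ ((lv x', lv y', s z) |` G').
  rewrite !mren_cons s'L' (eq_mren s'R) /fren /= s'x s'y; apply; first by rewrite s's.
  move=> [[a b] c] /fset1UP[[-> -> ->]|abcG]; first by rewrite /rren /= s'x s'y s'z fset1U1.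
  have [xa xb xc] := xG _ _ _ abcG; have [ya yb yc] := yG _ _ _ abcG.
  by rewrite /rren /= !s's // fset1Ur //; apply: GG' abcG.
- move=> G Gam Del x y z A B xy [xG xL xR] [yG yL yR] _ IH s se G' GG'.
  have [x' [y' [xy' fx' fy']]] :=
    fresh_pair G' (mren s Gam) (mren s ((z, Wand A B) +` Del)).
  pose s' a := if a == lv x then lv x' else if a == lv y then lv y' else s a.
  have s'x : s' (lv x) = lv x' by rewrite /s' eqxx.
  have s'y : s' (lv y) = lv y'.
    by rewrite /s' eqxx; case: eqP => // -[/esym].
  have s's a : a <> lv x -> a <> lv y -> s' a = s a.
    by move=> /eqP/negbTE ax /eqP/negbTE ay; rewrite /s' ax ay.
  have s'R f : f \in (z, Wand A B) +` Del -> s' f.1 = s f.1.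
    by case: f => a C aG; apply: s's; [apply: xR aG|apply: yR aG].
  have s'L f : f \in Gam -> s' f.1 = s f.1.
    by case: f => a C aG; apply: s's; [apply: xL aG|apply: yL aG].
  have s'z : s' z = s z by apply: (s'R (z, Wand A B)); apply: mset1D1.
  have s'R' : mren s' Del = mren s Del.
    by apply: eq_mren => f fG; apply: s'R; rewrite mset1Dr.
  move: fx' fy'; rewrite mren_cons => fx' fy'; apply: (LS_WandR xy') => //.
  have := IH s' _ ((lv x', s z, lv y') |` G').
  rewrite !mren_cons s'R' (eq_mren s'L) /fren /= s'x s'y; apply; first by rewrite s's.
  move=> [[a b] c] /fset1UP[[-> -> ->]|abcG]; first by rewrite /rren /= s'x s'y s'z fset1U1.
  have [xa xb xc] := xG _ _ _ abcG; have [ya yb yc] := yG _ _ _ abcG.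
  by rewrite /rren /= !s's // fset1Ur //; apply: GG' abcG.
- move=> G Gam Del x y z A B _ IH1 _ IH2 s se G' GG'.
  have := IH1 s se G' GG'; have := IH2 s se G' GG'; rewrite !mren_cons => D2 D1.
  by apply: LS_StarR_mem D1 D2; apply: (GG' (x, y, z)); apply: fset1U1.
- move=> G Gam Del x y z A B _ IH1 _ IH2 s se G' GG'.
  have := IH1 s se G' GG'; have := IH2 s se G' GG'; rewrite !mren_cons => D2 D1.
  by apply: LS_WandL_mem D1 D2; apply: (GG' (x, y, z)); apply: fset1U1.
- move=> G Gam Del x y z _ IH s se G' GG'.
  apply: (@LS_E_mem _ _ _ _ (s x) (s y) (s z)).
    by apply: (GG' (x, y, z)); apply: fset1U1.
  apply: IH => // r /fset1UP[->|rG]; first exact: fset1U1.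
  by apply: fset1Ur; apply: GG'.
- move=> G Gam Del x y z u v w [wG wL wR] _ IH s se G' GG'.
  have [w' [_ [_ fw' _]]] := fresh_pair G' (mren s Gam) (mren s Del).
  apply: (@LS_A_mem _ _ _ _ (s x) (s y) (s z) (s u) (s v) w') => //.
  + by apply: (GG' (x, y, z)); rewrite !inE eqxx.
  + by apply: (GG' (u, v, x)); rewrite !inE eqxx orbT.
  pose s' a := if a == lv w then lv w' else s a.
  have s'w : s' (lv w) = lv w' by rewrite /s' eqxx.
  have s's a : a <> lv w -> s' a = s a by move=> /eqP/negbTE aw; rewrite /s' aw.
  rewrite -(@eq_mren s' s Gam); last by case=> a C /wL /= /s's.
  rewrite -(@eq_mren s' s Del); last by case=> a C /wR /= /s's.
  have [wx wy wz] := wG x y z (fset1U1 _ _).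
  have [wu wv _] := wG u v x (fset1Ur _ (fset1U1 _ _)).
  apply: IH; first by rewrite s's.
  move=> r /fset1UP[->|/fset1UP[->|]].
  + by rewrite /rren /= s'w !s's // fset1U1.
  + by rewrite /rren /= s'w !s's // fset1Ur // fset1U1.
  case: r => [[a b] c] abcG; have [wa wb wc] := wG _ _ _ abcG.
  by rewrite /rren /= !s's //; do 2!apply: fset1Ur; apply: GG' abcG.
- move=> G Gam Del x _ IH s se G' GG'; apply: (@LS_U _ _ _ _ _ (s x)).
  apply: IH => // r /fset1UP[->|rG]; last by apply: fset1Ur; apply: GG'.
  by rewrite /rren /= se fset1U1.
(* A_C is the instance of A in which both principal atoms coincide. *)
- move=> G Gam Del x y w [wG wL wR] _ IH s se G' GG'.
  have [w' [_ [_ fw' _]]] := fresh_pair G' (mren s Gam) (mren s Del).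
  apply: (@LS_A_mem _ _ _ _ (s x) (s y) (s x) (s x) (s y) w') => //.
  + by apply: (GG' (x, y, x)); rewrite !inE eqxx.
  + by apply: (GG' (x, y, x)); rewrite !inE eqxx.
  pose s' a := if a == lv w then lv w' else s a.
  have s'w : s' (lv w) = lv w' by rewrite /s' eqxx.
  have s's a : a <> lv w -> s' a = s a by move=> /eqP/negbTE aw; rewrite /s' aw.
  rewrite -(@eq_mren s' s Gam); last by case=> a C /wL /= /s's.
  rewrite -(@eq_mren s' s Del); last by case=> a C /wR /= /s's.
  have [wx wy _] := wG x y x (fset1U1 _ _).
  apply: IH; first by rewrite s's.
  move=> r /fset1UP[->|/fset1UP[->|]].
  + by rewrite /rren /= s'w !s's // fset1U1.
  + by rewrite /rren /= s'w !s's // fset1Ur // fset1U1.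
  case: r => [[a b] c] abcG; have [wa wb wc] := wG _ _ _ abcG.
  by rewrite /rren /= !s's //; do 2!apply: fset1Ur; apply: GG' abcG.
- move=> G Gam Del w w' _ IH s se G' GG'.
  have wG' : (eps, s (lv w), s w') \in G'.
    by have := GG' (eps, lv w, w') (fset1U1 _ _); rewrite /rren /= se.
  (* The rule itself may be lost under renaming, since [s (lv w)] can be [eps]. Instead the two
     image labels are equated by a further renaming [t], and the induction hypothesis is used for
     [t \o s]. The remaining substituting rules go the same way. *)
  apply: (unifiable_Eq wG') => t te tw G'' G'G''; rewrite !mren_comp.
  have tse : (t \o s) eps = eps by rewrite /= se.
  apply: (derivable_under_subst (IH _ tse)) => //=.
    by have := G'G'' _ wG'; rewrite /rren /= te tw se te.
  by move=> r rG; apply: (G'G'' (rren s r)); apply: GG'; rewrite fset1Ur.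
- move=> G Gam Del w w' _ IH s se G' GG'.
  have wG' : (eps, s w', s (lv w)) \in G'.
    by have := GG' (eps, w', lv w) (fset1U1 _ _); rewrite /rren /= se.
  apply: (unifiable_Eq wG') => t te tw G'' G'G''; rewrite !mren_comp.
  have tse : (t \o s) eps = eps by rewrite /= se.
  apply: (derivable_under_subst (IH _ tse)) => //=.
    by have := G'G'' _ wG'; rewrite /rren /= te -tw se te.
  by move=> r rG; apply: (G'G'' (rren s r)); apply: GG'; rewrite fset1Ur.
- move=> G Gam Del x y z w _ IH s se G' GG'.
  have zG' := GG' (x, y, z) (fset1U1 _ _).
  have wG' := GG' (x, y, lv w) (fset1Ur _ (fset1U1 _ _)).
  apply: (unifiable_P zG' wG') => t te tw G'' G'G''; rewrite !mren_comp.
  have tse : (t \o s) eps = eps by rewrite /= se.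
  apply: (derivable_under_subst (IH _ tse)) => //=; first exact: G'G'' zG'.
  by move=> r rG; apply: (G'G'' (rren s r)); apply: GG'; do 2!apply: fset1Ur.
- move=> G Gam Del x y z w _ IH s se G' GG'.
  have yG' := GG' (x, y, z) (fset1U1 _ _).
  have wG' := GG' (x, lv w, z) (fset1Ur _ (fset1U1 _ _)).
  apply: (unifiable_C yG' wG') => t te tw G'' G'G''; rewrite !mren_comp.
  have tse : (t \o s) eps = eps by rewrite /= se.
  apply: (derivable_under_subst (IH _ tse)) => //=; first exact: G'G'' yG'.
  by move=> r rG; apply: (G'G'' (rren s r)); apply: GG'; do 2!apply: fset1Ur.
- move=> G Gam Del x y _ IH s se G' GG'.
  have xG' := GG' (lv x, lv x, y) (fset1U1 _ _).
  apply: (unifiable_D xG') => t te tx G'' G'G''; rewrite !mren_comp.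
  have tse : (t \o s) eps = eps by rewrite /= se.
  apply: (derivable_under_subst (IH _ tse)) => //=; first by rewrite tx se.
    by have := G'G'' _ xG'; rewrite /rren /= tx se te.
  by move=> r rG; apply: (G'G'' (rren s r)); apply: GG'; rewrite fset1Ur.
Qed.

(** * Construction of a Hintikka set *)

Lemma LS_add_eq a b G Gam Del : unifiable a b G Gam Del ->
  LSPASLD false ((eps, a, b) |` G) Gam Del -> LSPASLD false G Gam Del.
Proof.
move=> abU D; apply: abU => s se sab G' GG'.
apply: (@LS_U _ _ _ _ _ (s b)); apply: LS_E_mem (fset1U1 _ _) _.
apply: (LS_ren D se) => r /fset1UP[->|/GG' ?]; last by do 2!apply: fset1Ur.
by rewrite /rren /= se sab fset1U1.
Qed.

(** Once [a] and [b] are identified, [r'] coincides with an atom already present. This closes the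
    atoms under replacement of equals. *)
Lemma LS_congr a b r r' G Gam Del :
    (eps, a, b) \in G -> r \in G ->
    (forall s, s a = s b -> rren s r' = rren s r) ->
  LSPASLD false (r' |` G) Gam Del -> LSPASLD false G Gam Del.
Proof.
move=> abG rG rr' D; apply: (unifiable_Eq abG) => s se sab G' GG'.
by apply: (LS_ren D se) => r0 /fset1UP[->|/GG'//]; rewrite rr' //; apply: GG'.
Qed.

(** * Signed formulae and states of the branch *)

Definition sformula : choiceType := (bool * lformula Var)%type.
Implicit Types (f : sformula) (L K : seq sformula).

Definition side (b : bool) L : {mset lformula Var} :=
  seq_mset [seq f.2 | f <- L & f.1 == b].

Definition derivable G L := LSPASLD false G (side true L) (side false L).

Lemma side_cons b f L :
  side b (f :: L) = if f.1 == b then f.2 +` side b L else side b L.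
Proof. by rewrite /side /=; case: ifP => //= _; rewrite mset_cons. Qed.

Lemma side_mem b L g : (b, g) \in L -> g \in side b L.
Proof.
move=> gL; rewrite /side (perm_mem (perm_eq_seq_mset _)); apply/mapP.
by exists (b, g) => //; rewrite mem_filter eqxx.
Qed.

Lemma derivable_rem f G L : f \in L -> derivable G (f :: rem f L) -> derivable G L.
Proof.
move=> fL; rewrite /derivable => D.
have E b : side b L = side b (f :: rem f L).
  by apply/eq_seq_msetP/perm_map/perm_filter/perm_to_rem.
by rewrite !E.
Qed.

(* [current] is the sequent reached on the branch, with [true] marking its
   antecedent and [false] its succedent; [seen] keeps the formulae that the rules
   have consumed. *)
Record state := State { atoms : {fset ratom}; current : seq sformula;
                        seen : seq sformula }.
Implicit Type S : state.

(** The default [False] is essential: with the invariant [good], it keeps the remaining formulae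
    (atoms, constants, star on the right, wand on the left) in [current] forever, available for
    axioms and repeated use. *)
Definition reduced (T : ratom -> Prop) (H : sformula -> Prop) f : Prop :=
  match f with
  | (true, (w, Emp)) => T (eps, w, eps)
  | (true, (w, And A B)) => H (true, (w, A)) /\ H (true, (w, B))
  | (false, (w, And A B)) => H (false, (w, A)) \/ H (false, (w, B))
  | (true, (w, Imp A B)) => H (false, (w, A)) \/ H (true, (w, B))
  | (false, (w, Imp A B)) => H (true, (w, A)) /\ H (false, (w, B))
  | (true, (w, Star A B)) =>
      exists x y, [/\ T (x, y, w), H (true, (x, A)) & H (true, (y, B))]
  | (false, (w, Wand A B)) =>
      exists x y, [/\ T (x, w, y), H (true, (x, A)) & H (false, (y, B))]
  | _ => False
  end.

Definition reducible f : bool :=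
  match f with
  | (true, (_, Emp)) | (_, (_, And _ _)) | (_, (_, Imp _ _))
  | (true, (_, Star _ _)) | (false, (_, Wand _ _)) => true
  | _ => false
  end.

(** Star on the right and wand on the left survive their rules and must be treated anew with each
    relational atom, hence a condition on an atom and a formula together. *)
Definition used (H : sformula -> Prop) (r : ratom) f : Prop :=
  match f with
  | (false, (z, Star A B)) =>
      z = r.2 -> H (false, (r.1.1, A)) \/ H (false, (r.1.2, B))
  | (true, (y, Wand A B)) =>
      y = r.1.2 -> H (false, (r.1.1, A)) \/ H (true, (r.2, B))
  | _ => True
  end.

Definition in_atoms S : ratom -> Prop := fun r => r \in atoms S.
Definition in_seen S : sformula -> Prop := fun f => f \in seen S.

Definition good S : Prop :=
  [/\ ~ derivable (atoms S) (current S), {subset current S <= seen S}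
    & forall f, f \in seen S ->
        f \in current S \/ reduced (in_atoms S) (in_seen S) f].

(** [current] is not compared, because it loses the formulae that rules consume. *)
Definition sle S S' : Prop :=
  {subset atoms S <= atoms S'} /\ {subset seen S <= seen S'}.

Lemma sle_refl S : sle S S. Proof. by split. Qed.
#[local] Hint Resolve sle_refl : core.

Lemma sle_trans S2 S1 S3 : sle S1 S2 -> sle S2 S3 -> sle S1 S3.
Proof. by move=> [a12 s12] [a23 s23]; split=> x; [move/a12/a23|move/s12/s23]. Qed.

Lemma reduced_mono (T T' : ratom -> Prop) (H H' : sformula -> Prop) f :
    (forall r, T r -> T' r) -> (forall g, H g -> H' g) ->
  reduced T H f -> reduced T' H' f.
Proof.
move=> TT' HH'; case: f => -[] [w [p|||A B|A B||A B|A B]] //=.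
- by move=> [? ?]; split; apply: HH'.
- by move=> [?|?]; [left|right]; apply: HH'.
- exact: TT'.
- by move=> [x [y [? ? ?]]]; exists x, y; split; [apply: TT'|apply: HH'|apply: HH'].
- by move=> [?|?]; [left|right]; apply: HH'.
- by move=> [? ?]; split; apply: HH'.
- by move=> [x [y [? ? ?]]]; exists x, y; split; [apply: TT'|apply: HH'|apply: HH'].
Qed.

Lemma used_mono (H H' : sformula -> Prop) r f :
  (forall g, H g -> H' g) -> used H r f -> used H' r f.
Proof.
move=> HH'; case: f => -[] [w [p|||A B|A B||A B|A B]] //= U /U [?|?];
  by [left; apply: HH'|right; apply: HH'].
Qed.

Lemma good_atoms S G : good S -> {subset atoms S <= G} ->
  ~ derivable G (current S) -> good (State G (current S) (seen S)).
Proof.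
move=> [_ cs sr] SG nD; split=> //= f /sr[fc|fr]; [by left|right].
by apply: reduced_mono fr => // r; apply: SG.
Qed.

Lemma good_add S f : good S -> ~ derivable (atoms S) (f :: current S) ->
  good (State (atoms S) (f :: current S) (f :: seen S)).
Proof.
move=> [_ cs sr] nD; split=> //= g; rewrite !inE => /orP[/eqP->|].
- by rewrite eqxx.
- by move/cs->; rewrite orbT.
- by left; rewrite eqxx.
- move=> /sr[->|gr]; first by left; rewrite orbT.
  right; apply: reduced_mono gr => // h hS.
  by rewrite /in_seen /= inE [_ \in seen S]hS orbT.
Qed.

Lemma good_reduce S f G K : good S -> f \in current S -> {subset atoms S <= G} ->
    ~ derivable G (K ++ rem f (current S)) ->
    reduced (fun r => r \in G) (fun g => g \in K ++ seen S) f ->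
  good (State G (K ++ rem f (current S)) (K ++ seen S)).
Proof.
move=> [nD cs sr] fc SG nD' fr; split=> //=.
  move=> g; rewrite !mem_cat => /orP[->//|/mem_rem/cs->]; exact: orbT.
move=> g; rewrite mem_cat => /orP[gK|gS]; first by left; rewrite mem_cat gK.
have [->|gf] := eqVneq g f; first by right.
case: (sr g gS) => [gc|gr]; last first.
  by right; apply: reduced_mono gr => // h hS; rewrite /in_seen /= mem_cat [_ \in seen S]hS orbT.
by left; move: gc; rewrite mem_cat (perm_mem (perm_to_rem fc)) inE (negbTE gf) /= => ->; rewrite orbT.
Qed.

(** Either [f] was consumed earlier and is reduced by the invariant, or it is still in [current] and
    its rule, read bottom-up, has an underivable premise to move to. *)
Lemma reduced_reachable S f : good S -> f \in seen S -> reducible f ->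
  exists S', [/\ good S', sle S S' & reduced (in_atoms S') (in_seen S') f].
Proof.
move=> gS fS rf; have [nD cs sr] := gS.
have [fc|fr] := sr f fS; last by exists S.
have reach G K : {subset atoms S <= G} ->
    (derivable G (K ++ rem f (current S)) -> derivable (atoms S) (f :: rem f (current S))) ->
    reduced (fun r => r \in G) (fun g => g \in K ++ seen S) f ->
    exists S', [/\ good S', sle S S' & reduced (in_atoms S') (in_seen S') f].
  move=> SG DD fr; exists (State G (K ++ rem f (current S)) (K ++ seen S)); split=> //.
    by apply: good_reduce => // /DD/(derivable_rem fc).
  by split=> //= g gS'; rewrite mem_cat gS' orbT.
have reach2 g1 g2 :
    (derivable (atoms S) (g1 :: rem f (current S)) ->
     derivable (atoms S) (g2 :: rem f (current S)) ->
     derivable (atoms S) (f :: rem f (current S))) ->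
    (forall H : sformula -> Prop, H g1 \/ H g2 -> reduced (in_atoms S) H f) ->
    exists S', [/\ good S', sle S S' & reduced (in_atoms S') (in_seen S') f].
  (* The premises cannot both be derivable, so excluded middle selects the one along which the
     branch continues. *)
  move=> DD fr; have [D1|nD1] := classic (derivable (atoms S) (g1 :: rem f (current S))).
    apply: (reach (atoms S) [:: g2]) => // [D2|]; first exact: DD.
    by apply: fr; right; rewrite mem_head.
  apply: (reach (atoms S) [:: g1]) => //; apply: fr; left; exact: mem_head.
have [x [y [xy xf yf]]] :=
  fresh_pair (atoms S) (side true (f :: rem f (current S)))
    (side false (f :: rem f (current S))).
move: fS fc rf reach reach2 xf yf; rewrite !side_cons.
case: f => -[] [w [p|||A B|A B||A B|A B]] //= _ _ _ reach reach2 xf yf.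
- apply: (reach (atoms S) [:: (true, (w, A)); (true, (w, B))]) => //.
    by rewrite /derivable !side_cons; apply: LS_AndL.
  by rewrite !inE !eqxx orbT.
- apply: (reach2 (false, (w, A)) (true, (w, B))) => //.
  by rewrite /derivable !side_cons; apply: LS_ImpL.
- apply: (reach ((eps, w, eps) |` atoms S) [::]) => //=; last exact: fset1U1.
    by move=> r; apply: fset1Ur.
  by rewrite /derivable !side_cons; apply: LS_EmpL.
- apply: (reach ((lv x, lv y, w) |` atoms S) [:: (true, (lv x, A)); (true, (lv y, B))]).
  + by move=> r; apply: fset1Ur.
  + by rewrite /derivable !side_cons; apply: LS_StarL xf yf.
  + by exists (lv x), (lv y); rewrite fset1U1 !inE !eqxx orbT.
- apply: (reach2 (false, (w, A)) (false, (w, B))) => //.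
  by rewrite /derivable !side_cons; apply: LS_AndR.
- apply: (reach (atoms S) [:: (true, (w, A)); (false, (w, B))]) => //.
    by rewrite /derivable !side_cons; apply: LS_ImpR.
  by rewrite !inE !eqxx orbT.
- apply: (reach ((lv x, w, lv y) |` atoms S) [:: (true, (lv x, A)); (false, (lv y, B))]).
  + by move=> r; apply: fset1Ur.
  + by rewrite /derivable !side_cons; apply: LS_WandR xf yf.
  + by exists (lv x), (lv y); rewrite fset1U1 !inE !eqxx orbT.
Qed.

(** The formula [f] stays in the sequent, so one premise formula is added to [current] instead of
    replacing [f]. *)
Lemma used_reachable S r f : good S -> r \in atoms S -> f \in seen S ->
  exists S', [/\ good S', sle S S' & used (in_seen S') r f].
Proof.
move=> gS rG fS; have [nD cs sr] := gS.
have reach g1 g2 : f \in current S ->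
    (derivable (atoms S) (g1 :: f :: rem f (current S)) ->
     derivable (atoms S) (g2 :: f :: rem f (current S)) ->
     derivable (atoms S) (f :: rem f (current S))) ->
    exists S', [/\ good S', sle S S' & in_seen S' g1 \/ in_seen S' g2].
  move=> fc DD.
  have add g : ~ derivable (atoms S) (g :: current S) ->
      exists S', [/\ good S', sle S S' & in_seen S' g].
    move=> nDg; exists (State (atoms S) (g :: current S) (g :: seen S)).
    split; [exact: good_add|by split=> //= h hS; rewrite inE hS orbT|exact: mem_head].
  have derivable_cons g : derivable (atoms S) (g :: current S) ->
      derivable (atoms S) (g :: f :: rem f (current S)).
    move=> D; rewrite /derivable.
    have E b : side b (g :: f :: rem f (current S)) = side b (g :: current S).
      apply/eq_seq_msetP/perm_map/perm_filter; rewrite perm_cons perm_sym.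
      exact: perm_to_rem.
    by rewrite !E.
  have [D1|/add[S' [gS' SS' g1S']]] := classic (derivable (atoms S) (g1 :: current S)).
    have [D2|/add[S' [gS' SS' g2S']]] := classic (derivable (atoms S) (g2 :: current S)).
      by case: nD; apply: (derivable_rem fc); apply: DD; apply: derivable_cons.
    by exists S'; split=> //; right.
  by exists S'; split=> //; left.
have := sr f fS; move: rG reach; case: r => [[x y] z].
case: f fS => -[] [w [p|||A B|A B||A B|A B]] fS //= rG reach fr;
  try by exists S; split.
- have [wy|wy] := eqVneq w y; last first.
    by exists S; split=> // ywE; rewrite ywE eqxx in wy.
  have [||S' [gS' SS' g12]] := reach (false, (x, A)) (true, (z, B)).
  (* [reduced] is [False] on this formula, so it must still be in [current]. *)
  + by case: fr.
  + rewrite /derivable !side_cons /= wy => D1 D2; apply: (LS_WandL_mem rG) => //.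
    by rewrite msetDCA.
  + by exists S'.
- have [wz|wz] := eqVneq w z; last first.
    by exists S; split=> // wzE; rewrite wzE eqxx in wz.
  have [||S' [gS' SS' g12]] := reach (false, (x, A)) (false, (y, B)).
  + by case: fr.
  + by rewrite /derivable !side_cons /= wz => D1 D2; apply: (LS_StarR_mem rG).
  + by exists S'.
Qed.

(** Closure under E and under D, the latter with its equation recorded as an atom. *)
Definition swap_closed (T : ratom -> Prop) (r : ratom) : Prop :=
  T (r.1.2, r.1.1, r.2) /\ (r.1.1 = r.1.2 -> T (eps, r.1.1, eps)).

(** The clauses are, in order: A (with A_C as the case of equal atoms), replacement of equals in the
    first and in the third component, P, and C. Replacement in the second component follows by
    swapping. *)
Definition pair_closed (T : ratom -> Prop) (r1 r2 : ratom) : Prop :=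
  [/\ r2.2 = r1.1.1 ->
        exists w, T (r2.1.1, w, r1.2) /\ T (r1.1.2, r2.1.2, w),
      r1.1.1 = eps -> r1.1.2 = r2.1.1 -> T (r1.2, r2.1.2, r2.2),
      r1.1.1 = eps -> r1.1.2 = r2.2 -> T (r2.1.1, r2.1.2, r1.2),
      r1.1 = r2.1 -> T (eps, r1.2, r2.2)
    & r1.1.1 = r2.1.1 -> r1.2 = r2.2 -> T (eps, r1.1.2, r2.1.2)].

Definition consistent (T : ratom -> Prop) (H : sformula -> Prop) : Prop :=
  [/\ forall a, ~ H (true, (a, Bot)), forall a, ~ H (false, (a, Top)),
      forall a b p, H (true, (a, Atom p)) -> H (false, (b, Atom p)) -> ~ T (eps, a, b)
    & forall a, H (false, (a, Emp)) -> ~ T (eps, a, eps)].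

Record hintikka (T : ratom -> Prop) (H : sformula -> Prop) : Prop := Hintikka {
  hintikka_unit : forall a, T (a, eps, a);
  hintikka_swap : forall r, T r -> swap_closed T r;
  hintikka_pair : forall r1 r2, T r1 -> T r2 -> pair_closed T r1 r2;
  hintikka_reduced : forall f, H f -> reducible f -> reduced T H f;
  hintikka_used : forall r f, T r -> H f -> used H r f;
  hintikka_consistent : consistent T H
}.

(** The formulae concerned are never consumed, so a violation would make the current sequent an
    axiom, after identifying two labels where an equation is involved. *)
Lemma good_consistent S : good S -> consistent (in_atoms S) (in_seen S).
Proof.
move=> [nD cs sr]; split.
- move=> a /sr[/side_mem/msetB1K E|//]; apply: nD; rewrite /derivable -E.
  exact: LS_BotL.
- move=> a /sr[/side_mem/msetB1K E|//]; apply: nD; rewrite /derivable -E.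
  exact: LS_TopR.
- move=> a b p /sr[/side_mem/msetB1K Ea|//] /sr[/side_mem/msetB1K Eb|//] abT.
  apply: nD; apply: (unifiable_Eq abT) => s _ sab G' _.
  by rewrite -Ea -Eb !mren_cons /fren /= sab; apply: LS_id.
- move=> a /sr[/side_mem/msetB1K E|//] aT; apply: nD.
  apply: (unifiable_Eq aT) => s se sae G' _.
  by rewrite -E !mren_cons /fren /= sae se; apply: LS_EmpR.
Qed.

(** * Fair scheduling of the rules *)

(** Goals that persist, and that can be reached from every good extension of [S0], can be achieved
    one after another; this gives closure under finite conjunctions. *)
Definition attainable S0 (P : state -> Prop) : Prop :=
  (forall S S', sle S S' -> P S -> P S') /\
  (forall S, good S -> sle S0 S -> exists S', [/\ good S', sle S S' & P S']).

Lemma attainable_and S0 P Q :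
  attainable S0 P -> attainable S0 Q -> attainable S0 (fun S => P S /\ Q S).
Proof.
move=> [Pm Pr] [Qm Qr]; split.
  by move=> S S' SS' [PS QS]; split; [apply: Pm PS|apply: Qm QS].
move=> S gS S0S; have [S1 [gS1 SS1 PS1]] := Pr S gS S0S.
have [S2 [gS2 S12 QS2]] := Qr S1 gS1 (sle_trans S0S SS1).
by exists S2; split=> //; [apply: sle_trans S12|split=> //; apply: Pm PS1].
Qed.

Lemma attainable_imp S0 (A : Prop) P :
  (A -> attainable S0 P) -> attainable S0 (fun S => A -> P S).
Proof.
move=> AP; have [a|na] := classic A; last first.
  by split=> // S gS _; exists S; split.
have [Pm Pr] := AP a; split; first by move=> S S' SS' + _ => /(_ a); apply: Pm.
by move=> S gS S0S; have [S' [? ? ?]] := Pr S gS S0S; exists S'; split.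
Qed.

Lemma attainable_all S0 (I : eqType) (r : seq I) (P : I -> state -> Prop) :
  (forall i, i \in r -> attainable S0 (P i)) ->
  attainable S0 (fun S => forall i, i \in r -> P i S).
Proof.
elim: r => [|i r IH] Pr; first by split=> // S gS _; exists S; split.
have [||m a] := @attainable_and S0 (P i) (fun S => forall j, j \in r -> P j S).
- by apply: Pr; rewrite mem_head.
- by apply: IH => j jr; apply: Pr; rewrite inE jr orbT.
split; first by move=> S S' SS' PS j jr; apply: (proj1 (Pr j jr)) (PS j jr).
move=> S gS /(a S gS)[S' [gS' SS' [Pi Pj]]]; exists S'; split=> // j.
by rewrite inE => /orP[/eqP->|/Pj].
Qed.

Lemma attainable_atom S0 r :
    (forall G Gam Del, {subset atoms S0 <= G} ->
      LSPASLD false (r |` G) Gam Del -> LSPASLD false G Gam Del) ->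
  attainable S0 (fun S => in_atoms S r).
Proof.
move=> rD; split; first by move=> S S' [SS' _] /SS'.
move=> S gS [S0S _]; exists (State (r |` atoms S) (current S) (seen S)).
split; last exact: fset1U1.
- by apply: good_atoms => //; [move=> ? ?; apply: fset1Ur|move/(rD _ _ _ S0S); case: gS].
- by split=> //= ? ?; apply: fset1Ur.
Qed.

(** The eigenvariable must be fresh for the state reached, not just for [S0], so no fixed atom can
    serve as the goal. *)
Lemma attainable_assoc S0 x y z u v :
    (x, y, z) \in atoms S0 -> (u, v, x) \in atoms S0 ->
  attainable S0 (fun S => exists w, in_atoms S (u, w, z) /\ in_atoms S (y, v, w)).
Proof.
move=> zS uS; split; first by move=> S S' [SS' _] [w [/SS' ? /SS' ?]]; exists w.
move=> S gS [S0S _].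
have [w [_ [_ fw _]]] :=
  fresh_pair (atoms S) (side true (current S)) (side false (current S)).
exists (State ((u, lv w, z) |` ((y, v, lv w) |` atoms S)) (current S) (seen S)); split.
- apply: good_atoms => //; first by move=> ? ?; do 2!apply: fset1Ur.
  by move/(LS_A_mem (S0S _ zS) (S0S _ uS) fw); case: gS.
- by split=> //= ? ?; do 2!apply: fset1Ur.
- by exists (lv w); rewrite /in_atoms /= !inE !eqxx orbT.
Qed.

Definition nth_label k : label := if k is n.+1 then lv n else eps.

(** One round of the strategy: every obligation coming from the finite state [S0] is met in [S], and
    U is applied to the label numbered [k], so that all labels get their turn. *)
Definition successor k S0 S : Prop :=
  in_atoms S (nth_label k, eps, nth_label k) /\
  (forall r, r \in enum_fset (atoms S0) -> swap_closed (in_atoms S) r) /\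
  (forall r1, r1 \in enum_fset (atoms S0) ->
   forall r2, r2 \in enum_fset (atoms S0) -> pair_closed (in_atoms S) r1 r2) /\
  (forall f, f \in seen S0 -> reducible f -> reduced (in_atoms S) (in_seen S) f) /\
  (forall r, r \in enum_fset (atoms S0) ->
   forall f, f \in seen S0 -> used (in_seen S) r f).

Lemma attainable_ext S0 (P Q : state -> Prop) :
  (forall S, P S <-> Q S) -> attainable S0 P -> attainable S0 Q.
Proof.
move=> PQ [Pm Pr]; split; first by move=> S S' SS' /PQ/(Pm _ _ SS')/PQ.
by move=> S gS /(Pr S gS)[S' [? ? /PQ ?]]; exists S'.
Qed.

Lemma attainable_swap S0 r : r \in atoms S0 ->
  attainable S0 (fun S => swap_closed (in_atoms S) r).
Proof.
case: r => [[x y] z] rS; apply: attainable_and.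
  by apply: attainable_atom => G Gam Del SG; apply: LS_E_mem; apply: SG.
apply: attainable_imp => /= xy; rewrite {}xy in rS *.
apply: attainable_atom => G Gam Del SG; apply: LS_add_eq.
exact: (unifiable_D (SG _ rS)).
Qed.

Lemma attainable_pair S0 r1 r2 : r1 \in atoms S0 -> r2 \in atoms S0 ->
  attainable S0 (fun S => pair_closed (in_atoms S) r1 r2).
Proof.
case: r1 r2 => [[x y] z] [[u v] t] r1S r2S; rewrite /pair_closed /=.
suff: attainable S0 (fun S =>
    (t = x -> exists w, in_atoms S (u, w, z) /\ in_atoms S (y, v, w)) /\
    (x = eps -> y = u -> in_atoms S (z, v, t)) /\
    (x = eps -> y = t -> in_atoms S (u, v, z)) /\
    ((x, y) = (u, v) -> in_atoms S (eps, z, t)) /\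
    (x = u -> z = t -> in_atoms S (eps, y, v))).
  by apply: attainable_ext => S; split=> [[? [? [? []]]]|[]].
do 4?apply: attainable_and.
- by apply: attainable_imp => tx; rewrite tx in r2S; apply: attainable_assoc r1S r2S.
- apply: attainable_imp => xe; apply: attainable_imp => yu; subst x y.
  apply: attainable_atom => G Gam Del SG.
  by apply: LS_congr (SG _ r1S) (SG _ r2S) _ => s; rewrite /rren /= => ->.
- apply: attainable_imp => xe; apply: attainable_imp => yt; subst x y.
  apply: attainable_atom => G Gam Del SG.
  by apply: LS_congr (SG _ r1S) (SG _ r2S) _ => s; rewrite /rren /= => ->.
- apply: attainable_imp => -[xu yv]; subst x y.
  apply: attainable_atom => G Gam Del SG.
  by apply: LS_add_eq; apply: unifiable_P (SG _ r1S) (SG _ r2S).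
- apply: attainable_imp => xu; apply: attainable_imp => zt; subst x z.
  apply: attainable_atom => G Gam Del SG.
  by apply: LS_add_eq; apply: unifiable_C (SG _ r1S) (SG _ r2S).
Qed.

Lemma successor_exists k S : good S -> exists S', [/\ good S', sle S S' & successor k S S'].
Proof.
suff [_ a] : attainable S (successor k S) by move=> gS; apply: a.
do 4?apply: attainable_and.
- by apply: attainable_atom => G Gam Del _; apply: LS_U.
- by apply: attainable_all => r; apply: attainable_swap.
- apply: attainable_all => r1 r1S; apply: attainable_all => r2.
  exact: attainable_pair.
- apply: attainable_all => f fS; apply: attainable_imp => rf; split.
    move=> S1 S2 [a12 s12]; apply: reduced_mono => x; [exact: a12|exact: s12].
  by move=> S1 gS1 [_ s1]; apply: reduced_reachable => //; apply: s1.
- apply: attainable_all => r rS; apply: attainable_all => f fS; split.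
    by move=> S1 S2 [_ s12]; apply: used_mono => x; apply: s12.
  by move=> S1 gS1 [a1 s1]; apply: used_reachable => //; [apply: a1|apply: s1].
Qed.

(** The Hintikka set is the union of a chain of rounds obtained by choice. Each condition has
    finitely many premises, which occur together at some stage and are treated in the next round or
    contradict [good_consistent]. *)
Lemma hintikka_extension S0 : good S0 ->
  exists T H, hintikka T H /\ forall f, f \in seen S0 -> H f.
Proof.
move=> gS0.
have next k (S : {S | good S}) : {S' | good S' /\ sle (sval S) S' /\ successor k (sval S) S'}.
  apply: constructive_indefinite_description.
  by have [S' [? ? ?]] := successor_exists k (proj2_sig S); exists S'.
pose fix chain k : {S | good S} :=
  if k is n.+1 then
    exist _ (sval (next n (chain n))) (proj1 (proj2_sig (next n (chain n))))
  else exist _ S0 gS0.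
pose S k := sval (chain k).
have gS k : good (S k) by apply: (proj2_sig (chain k)).
have SS k : sle (S k) (S k.+1) by case: (proj2_sig (next k (chain k))) => _ [].
have sS k : successor k (S k) (S k.+1) by case: (proj2_sig (next k (chain k))) => _ [].
have Sle m n : m <= n -> sle (S m) (S n).
  elim: n => [|n IH]; first by rewrite leqn0 => /eqP->; apply: sle_refl.
  rewrite leq_eqVlt ltnS => /orP[/eqP->|/IH mn]; first exact: sle_refl.
  exact: sle_trans mn (SS n).
pose T r := exists k, in_atoms (S k) r; pose H f := exists k, in_seen (S k) f.
have TS k r : in_atoms (S k) r -> T r by exists k.
have HS k f : in_seen (S k) f -> H f by exists k.
have lift k m r : in_atoms (S k) r -> k <= m -> in_atoms (S m) r.
  by move=> kr /Sle[+ _]; apply.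
have liftH k m f : in_seen (S k) f -> k <= m -> in_seen (S m) f.
  by move=> kf /Sle[_]; apply.
exists T, H; split; last by move=> f fS0; exists 0.
split.
(* [eps] has number 0 and [lv n] number [n.+1]; the atom given by U appears one stage later. *)
- move=> a; exists (if a is Some n then n.+2 else 1).
  by case: a => [n|]; [case: (sS n.+1)|case: (sS 0)].
- move=> r [k kr]; have [_ [/(_ r kr)[r1 r2] _]] := sS k.
  by split=> [|/r2]; apply: (TS k.+1).
- move=> r1 r2 [k1 k1r] [k2 k2r]; set k := maxn k1 k2.
  have [_ [_ [Hp _]]] := sS k.
  have [] := Hp r1 (lift _ _ _ k1r (leq_maxl _ _)) r2 (lift _ _ _ k2r (leq_maxr _ _)).
  move=> a b c d e; split.
  + by move=> /a[w [? ?]]; exists w; split; apply: TS; eassumption.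
  + by move=> h1 h2; apply: TS; apply: b h1 h2.
  + by move=> h1 h2; apply: TS; apply: c h1 h2.
  + by move=> h1; apply: TS; apply: d h1.
  + by move=> h1 h2; apply: TS; apply: e h1 h2.
- move=> f [k kf] rf; have [_ [_ [_ [Hr _]]]] := sS k.
  by apply: reduced_mono (Hr f kf rf) => x; [apply: TS|apply: HS].
- move=> r f [k1 k1r] [k2 k2f]; set k := maxn k1 k2.
  have [_ [_ [_ [_ Hu]]]] := sS k.
  apply: used_mono (Hu r (lift _ _ _ k1r (leq_maxl _ _)) f (liftH _ _ _ k2f (leq_maxr _ _))).
  by move=> x; apply: HS.
- split.
  + by move=> a [k]; have [+ _ _ _] := good_consistent (gS k); apply.
  + by move=> a [k]; have [_ + _ _] := good_consistent (gS k); apply.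
  + move=> a b p [k1 h1] [k2 h2] [k3 h3].
    pose k := maxn k1 (maxn k2 k3).
    have [_ _ + _] := good_consistent (gS k); apply.
    * exact: liftH h1 (leq_maxl _ _).
    * by apply: liftH h2 _; rewrite /k !leq_max leqnn orbT.
    * by apply: lift h3 _; rewrite /k !leq_max leqnn !orbT.
  + move=> a [k1 h1] [k2 h2]; have [_ _ _ +] := good_consistent (gS (maxn k1 k2)).
    apply; first exact: liftH h1 (leq_maxl _ _).
    exact: lift h2 (leq_maxr _ _).
Qed.

End Calculus.

(** * The canonical model *)

Section CanonicalModel.
Variables (Var : choiceType) (T : ratom -> Prop) (H : sformula Var -> Prop).
Hypothesis TH : hintikka T H.

Lemma T_comm x y z : T (x, y, z) -> T (y, x, z).
Proof. by move=> /(hintikka_swap TH)[]. Qed.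

Lemma T_refl a : T (eps, a, a).
Proof. exact/T_comm/(hintikka_unit TH). Qed.

Lemma T_subst3 a b x y : T (eps, a, b) -> T (x, y, a) -> T (x, y, b).
Proof. by move=> ab xya; case: (hintikka_pair TH ab xya) => _ _ + _ _; apply. Qed.

Lemma T_subst1 a b y z : T (eps, a, b) -> T (a, y, z) -> T (b, y, z).
Proof. by move=> ab ayz; case: (hintikka_pair TH ab ayz) => _ + _ _ _; apply. Qed.

Lemma T_subst2 a b x z : T (eps, a, b) -> T (x, a, z) -> T (x, b, z).
Proof. by move=> ab /T_comm/(T_subst1 ab)/T_comm. Qed.

Lemma T_cancel x y y' z : T (x, y, z) -> T (x, y', z) -> T (eps, y, y').
Proof. by move=> xy xy'; case: (hintikka_pair TH xy xy') => _ _ _ _; apply. Qed.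

(** Symmetry comes from cancellation: [b] and [a] both compose with [eps] to [b]. *)
Lemma T_sym a b : T (eps, a, b) -> T (eps, b, a).
Proof. by move=> ab; apply: T_cancel (T_refl b) ab. Qed.

Definition equated (a : label) : pred label := fun b =>
  if excluded_middle_informative (T (eps, a, b)) then true else false.

Lemma equatedP a b : reflect (T (eps, a, b)) (equated a b).
Proof. by rewrite /equated; case: excluded_middle_informative => ?; constructor. Qed.

Lemma equated_ex a : exists b, equated a b.
Proof. by exists a; apply/equatedP/T_refl. Qed.

(** [xchoose] depends only on the extension of the predicate, so equated labels get the same
    representative. Worlds can then be a subtype of labels, in which the frame axioms hold with
    Leibniz equality. *)
Definition rep a : label := xchoose (equated_ex a).

Lemma T_rep a : T (eps, a, rep a).
Proof. exact/equatedP/(xchooseP (equated_ex a)). Qed.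

Lemma eq_rep a b : T (eps, a, b) -> rep a = rep b.
Proof.
move=> ab; apply: eq_xchoose => c; apply/equatedP/equatedP => h.
  exact: T_subst3 h (T_sym ab).
exact: T_subst3 h ab.
Qed.

Lemma rep_idem a : rep (rep a) == rep a.
Proof. by apply/eqP/esym/eq_rep/T_rep. Qed.

Definition canonical_world : Type := {a : label | rep a == a}.
Definition canonical_class a : canonical_world := exist _ (rep a) (rep_idem a).
Definition canonical_R (h1 h2 h3 : canonical_world) : Prop :=
  T (val h1, val h2, val h3).

Lemma canonical_world_eq (h1 h2 : canonical_world) :
  T (eps, val h1, val h2) -> h1 = h2.
Proof.
case: h1 h2 => [a aP] [b bP] /= ab; apply: val_inj => /=.
by rewrite -(eqP aP) -(eqP bP); apply: eq_rep.
Qed.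

Lemma canonical_class_val h : canonical_class (val h) = h.
Proof. by apply/val_inj/eqP; case: h. Qed.

Lemma canonical_identity h1 h2 :
  canonical_R h1 (canonical_class eps) h2 <-> h1 = h2.
Proof.
rewrite /canonical_R /=; split=> [|->].
  by move=> /(T_subst2 (T_sym (T_rep eps)))/T_comm/canonical_world_eq.
by apply: T_subst2 (T_rep eps) _; apply: hintikka_unit TH _.
Qed.

Lemma canonical_commutativity h1 h2 h3 :
  canonical_R h1 h2 h3 <-> canonical_R h2 h1 h3.
Proof. by split=> /T_comm. Qed.

Lemma canonical_associativity h1 h2 h3 h4 h5 :
  canonical_R h1 h5 h4 -> canonical_R h2 h3 h5 ->
  exists h6, canonical_R h6 h3 h4 /\ canonical_R h1 h2 h6.
Proof.
move=> /T_comm h514 /T_comm h325.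
case: (hintikka_pair TH h514 h325) => /(_ erefl)[w [/T_comm w1 w2]] _ _ _ _.
exists (canonical_class w); split; first exact: T_subst1 (T_rep w) w1.
exact: T_subst3 (T_rep w) w2.
Qed.

Lemma canonical_cancellativity h1 h2 h3 h4 :
  canonical_R h1 h2 h3 -> canonical_R h1 h4 h3 -> h2 = h4.
Proof. by move=> h123 h143; apply/canonical_world_eq/(T_cancel h123 h143). Qed.

Lemma canonical_partial_determinism h1 h2 h3 h4 :
  canonical_R h1 h2 h3 -> canonical_R h1 h2 h4 -> h3 = h4.
Proof.
move=> h123 h124; apply: canonical_world_eq.
by case: (hintikka_pair TH h123 h124) => _ _ _ + _; apply.
Qed.

Definition canonical_frame : pasl_frame :=
  PaslFrame canonical_identity canonical_commutativity canonical_associativity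
    canonical_cancellativity canonical_partial_determinism.

Lemma canonical_disjoint : disjoint_frame canonical_frame.
Proof.
move=> h1 h2 h112; apply: canonical_world_eq.
have [_ /(_ erefl) h1e] := hintikka_swap TH h112.
exact: T_subst3 (T_rep eps) h1e.
Qed.

(** Labels are never substituted, so an atom may sit at any label of the class and not only at its
    representative. *)
Definition canonical_nu (p : Var) (h : canonical_frame) : Prop :=
  exists2 a, T (eps, a, val h) & H (true, (a, Atom p)).

(** Both signs are proved together, because implication and wand exchange them. Reducible formulae
    use [hintikka_reduced]; star on the right and wand on the left use [hintikka_used] with the atom
    given by the forcing clause. *)
Lemma truth A :
  (forall a, H (true, (a, A)) ->
     force canonical_nu (canonical_class a : canonical_frame) A) /\
  (forall a, H (false, (a, A)) ->
     ~ force canonical_nu (canonical_class a : canonical_frame) A).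
Proof.
have [nBot nTop nAtom nEmp] := hintikka_consistent TH.
have red := hintikka_reduced TH.
elim: A => [p|||A [A1 A0] B [B1 B0]|A [A1 A0] B [B1 B0]||
            A [A1 A0] B [B1 B0]|A [A1 A0] B [B1 B0]] /=; split=> a aF.
- by exists a => //; apply: T_rep.
- by move=> [b bA bp]; apply: nAtom bp aF _; apply: T_subst3 (T_sym (T_rep a)) bA.
- by [].
- by case: (nTop a).
- by case: (nBot a).
- by [].
- by have [/A1 ? /B1 ?] := red _ aF isT.
- by have [/A0 nA|/B0 nB] := red _ aF isT => -[].
- by have [/A0|/B1] := red _ aF isT.
- by have [/A1 hA /B0 nB] := red _ aF isT => /(_ hA).
- by apply/val_inj/eq_rep/(red _ aF isT).
- move=> /(congr1 val) /= ae; apply: nEmp aF _; apply: T_subst3 (T_sym (T_rep eps)) _.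
  by rewrite -ae; apply: T_rep.
- have [x [y [xya /A1 xA /B1 yB]]] := red _ aF isT.
  exists (canonical_class x), (canonical_class y); split=> //.
  apply: T_subst3 (T_rep a) _; apply: T_subst2 (T_rep y) _.
  exact: T_subst1 (T_rep x) xya.
- move=> [h1 [h2 [h12a h1A h2B]]].
  have ta : T (val h1, val h2, a) by apply: T_subst3 (T_sym (T_rep a)) h12a.
  by have /= [/A0|/B0] := hintikka_used TH ta aF erefl; rewrite canonical_class_val.
- move=> h1 h2 ah12 h1A.
  have ta : T (val h1, a, val h2).
    by apply: T_comm; apply: T_subst1 (T_sym (T_rep a)) ah12.
  by have /= [/A0|/B1] := hintikka_used TH ta aF erefl; rewrite canonical_class_val.
- have [x [y [xay /A1 xA /B0 yB]]] := red _ aF isT.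
  move=> /(_ (canonical_class x) (canonical_class y)) AB; apply: yB; apply: AB => //.
  apply: T_subst3 (T_rep y) _; apply: T_subst2 (T_rep x) _.
  by apply: T_subst1 (T_rep a) _; apply: T_comm.
Qed.

End CanonicalModel.

Theorem mainTheorem10 (Var : choiceType) (F : formula Var) :
  ((exists w : lvar, LSPASLD true fset0 mset0 [mset (lv w, F)]%mset) ->
   valid disjoint_frame F)
  /\
  (valid disjoint_frame F ->
   exists w : lvar, LSPASLD false fset0 mset0 [mset (lv w, F)]%mset).
Proof.
split=> [[w D] M Mdis nu h|Fvalid].
  (* The variable [w] denotes the arbitrary world [h], while [eps] still denotes the unit. *)
  pose rho (a : label) : M := if a == lv w then h else unit_world.
  have Gh r : r \in fset0 -> rholds rho r by rewrite in_fset0.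
  have Gamh f : f \in mset0 -> fholds nu rho f by rewrite in_mset0.
  have [f /mset1P->] := @LS_sound _ M nu _ _ _ _ Mdis D rho erefl Gh Gamh.
  by rewrite /fholds /rho eqxx.
(* Any label variable would do; if the sequent is underivable, it starts a branch whose canonical
   model refutes [F]. *)
exists 0; apply: NNPP => nD.
pose F0 : sformula Var := (false, (lv 0, F)).
have [|T [H [TH HF]]] := @hintikka_extension Var (State fset0 [:: F0] [:: F0]).
  split=> //= [D|f ->]; last by left.
  apply: nD; move: D; rewrite /derivable /= !side_cons /=.
  have side_nil b : side b [::] = mset0 :> {mset lformula Var}.
    by apply/msetP => g; rewrite /side mset_seqE mset0E.
  by rewrite !side_nil msetD0.
have [_ /(_ (lv 0)) nF] := truth TH F.
have hF : H F0 by apply: HF; rewrite mem_head.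
exact: (nF hF (Fvalid _ (@canonical_disjoint _ _ _ TH) _ _)).
Qed.
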